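(* Let $k,n,m>0$ be positive integers. Then $$D_k(q_n\circ q_m)=\sum_{I,J\in\mathbb{Z}^m}(-1)^{(I+J)\cdot\delta-k}\,q_{(I+J)\cdot\delta-k}(A)\,q_{n-|I|-|J|}(q_m)\prod_{s=1}^m q_{i_s}(q_{m-s})\,q_{j_s}(q_{m-s}),$$ where $I=(i_1,\ldots,i_m)$, $J=(j_1,\ldots,j_m)$, $\delta=(1,2,\ldots,m)$, $(I+J)\cdot\delta$ is the usual dot product, and $|I|=i_1+\cdots+i_m$, $|J|=j_1+\cdots+j_m$.
   Context: A strict partition is a finite weakly decreasing sequence of nonnegative integers $\lambda=(\lambda_1,\dots,\lambda_n)$ with no repeated nonzero parts. $\lambda\setminus\{\lambda_i\}:=(\lambda_1,\dots,\lambda_{i-1},\lambda_{i+1},\dots,\lambda_n)$. Let $A=\{a_1,a_2,\dots\}$ be an infinite alphabet of variables. Define $q_n=q_n(A)$ by $\kappa_z(A)=\prod_{a\in A}\frac{1+za}{1-za}=\sum_{n\in\mathbb{Z}}q_n(A)z^n$, so $q_0=1$ and $q_n=0$ for $n<0$. For $r,s\in\mathbb{Z}$ let $Q_{(r,s)}=q_rq_s+2\sum_{i=1}^s(-1)^iq_{r+i}q_{s-i}$. For $\lambda\in\mathbb{Z}^n$ with $n$ even, $Q_\lambda$ is the Pfaffian of the $n\times n$ skew-symmetric matrix whose $(i,j)$ entry is $Q_{(\lambda_i,\lambda_j)}$ for $i<j$; if $n$ is odd, $\lambda$ is replaced by $(\lambda_1,\dots,\lambda_n,0)$. Let $\Gamma=\mathbb{Q}[q_1,q_2,\dots]$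 be the ring generated by the $q_n$. The $Q_\lambda$ with $\lambda$ a strict partition form a basis of $\Gamma$. Plethysm. For a formal sum of monomials $P=\sum_\mu c_\mu x^\mu$, define $q_n(P)$ by $\prod_\mu\left(\frac{1+zx^\mu}{1-zx^\mu}\right)^{c_\mu}=\sum_n q_n(P)z^n$ (so $q_n(P)=0$ for $n<0$). For $G\in\Gamma$, $q_n\circ G=q_n(G)$ means $q_n(P)$ with $P=G(A)$ regarded as a formal sum of monomials in $A$; in particular $q_n(q_0)=q_n(1)$. Omitting the alphabet means the alphabet is $A$. Operator $D_k$ ($k$ a positive integer): the linear operator on $\Gamma$ with, for $\lambda$ a strict partition, $D_k(Q_\lambda)=(-1)^{i+1}2Q_{\lambda\setminus\{\lambda_i\}}$ if $k=\lambda_i$ for some $i$, and $D_k(Q_\lambda)=0$ otherwise. *)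

(* Defs.v *)
From HB Require Import structures.
From mathcomp Require Import all_boot all_order all_algebra all_fingroup.
From mathcomp Require Import finmap multiset.
From mathcomp Require Import all_classical.

Set Implicit Arguments.
Unset Strict Implicit.
Unset Printing Implicit Defensive.

Import GRing.Theory Num.Theory.
Local Open Scope classical_set_scope.
Local Open Scope ring_scope.

(** The infinite alphabet A is indexed by nat; a monomial in A is the finite
    multiset of its variables, so that the product of monomials is [msetD] and
    divisibility is [msubset]. *)
Definition monom := multiset nat.

Definition mdivs (nu : monom) : set monom := [set mu | msubset mu nu].

(** Formal, possibly infinite, rational combinations of monomials in A. *)
Definition formal := monom -> rat^o.

HB.instance Definition _ := gen_eqMixin formal.
HB.instance Definition _ := gen_choiceMixin formal.
HB.instance Definition _ := GRing.Lmodule.copy formal (monom -> rat^o).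

Definition mono (mu : monom) : formal := fun nu => (nu == mu)%:R.

Definition formal_mul (f g : formal) : formal := fun nu =>
  \sum_(mu \in mdivs nu) ((f mu : rat) * (g (msetB nu mu) : rat)).

Section RingAxioms.

Lemma finite_mdivs (nu : monom) : finite_set (mdivs nu).
Proof.
pose N := (\sum_(i <- finsupp nu) nu i)%N.
pose h (e : {ffun finsupp nu -> 'I_N.+1}) : monom :=
  [fsfun i in finsupp nu => (if insub i is Some j then (e j : nat) else 0)%N]%fset.
apply: (@sub_finite_set _ _ (range h)); last first.
  apply: finite_image; exact: finite_finset.
move=> mu /msubsetP le_mu.
exists [ffun j : finsupp nu => inord (mu (val j))] => //.
apply/fsfunP => i; rewrite fsfunE; case: ifPn => hi; last first.
  by apply/esym/eqP; rewrite -leqn0 (leq_trans (le_mu i)) // (fsfun_dflt hi).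
rewrite insubT /= ffunE inordK //= ltnS (leq_trans (le_mu i)) //.
by rewrite /N (big_fsetD1 i) //= leq_addr.
Qed.

Let dv (nu : monom) : {fset monom}%fset := fset_set (mdivs nu).

Let in_dv (nu mu : monom) : (mu \in dv nu) = msubset mu nu.
Proof.
rewrite in_fset_set; last exact: finite_mdivs.
by apply/idP/idP => [/set_mem//|h]; apply/mem_set.
Qed.

Let mulE (f g : formal) nu :
  formal_mul f g nu = \sum_(mu <- dv nu) (f mu : rat) * (g (msetB nu mu) : rat).
Proof. by rewrite /formal_mul fsbig_finite //; exact: finite_mdivs. Qed.

Lemma formal_mulC : commutative formal_mul.
Proof.
move=> f g; apply/funext => nu; rewrite !mulE.
have -> : dv nu = [fset msetB nu mu | mu in dv nu]%fset.
  apply/fsetP => mu; apply/idP/imfsetP => [|[rho]] /=; rewrite in_dv => hmu.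
    by exists (msetB nu mu); rewrite ?in_dv ?msubsetDl // msetBBK.
  by move=> ->; rewrite in_dv msubsetDl.
rewrite big_imfset /=; last first.
  move=> a b; rewrite !in_dv => ha hb eab.
  by rewrite -(msetBBK ha) eab msetBBK.
have -> : [fset msetB nu mu | mu in dv nu]%fset = dv nu.
  apply/fsetP => mu; apply/imfsetP/idP => [[rho] /=|]; rewrite in_dv => hmu.
    by move=> ->; rewrite in_dv msubsetDl.
  by exists (msetB nu mu); rewrite ?in_dv ?msubsetDl // msetBBK.
rewrite !big_seq; apply: eq_bigr => mu; rewrite in_dv => hmu.
by rewrite msetBBK // mulrC.
Qed.

Lemma formal_mulA : associative formal_mul.
Proof.
move=> f g h; apply/funext => nu; rewrite !mulE.
transitivity (\sum_(a <- dv nu) \sum_(e <- dv nu | msubset a e)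
   (f a : rat) * ((g (msetB e a) : rat) * (h (msetB nu e) : rat))); last first.
  rewrite (exchange_big_dep xpredT) //=.
  rewrite !big_seq; apply: eq_bigr => e; rewrite in_dv => he.
  rewrite mulE big_distrl /= -big_filter.
  rewrite (perm_big (dv e)) /=.
    by apply: eq_bigr => a _; rewrite mulrA.
  apply: uniq_perm; rewrite ?filter_uniq ?fset_uniq // => a.
  rewrite mem_filter !in_dv; case: (boolP (msubset a e)) => //= ae.
  exact: msubset_trans ae he.
rewrite !big_seq; apply: eq_bigr => a; rewrite in_dv => ha.
rewrite mulE big_distrr /= -[RHS]big_filter.
rewrite [RHS](perm_big [seq msetD a c | c <- dv (msetB nu a)]) /=.
  by rewrite big_map; apply: eq_bigr => c _; rewrite msetDKB msetBDA.
apply: uniq_perm; rewrite ?filter_uniq ?fset_uniq //.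
  by rewrite map_inj_uniq ?fset_uniq //; exact: can_inj (msetDKB a).
move=> e; rewrite mem_filter in_dv.
apply/andP/mapP => [[ae he]|[c]].
  exists (msetB e a); last by rewrite msetBDKC.
  by rewrite in_dv; apply/msubsetP => i; rewrite !msetE2 leq_sub2r //; apply/msubsetP: i.
rewrite in_dv => /msubsetP hc ->; split; apply/msubsetP => i; rewrite msetE2.
  exact: leq_addr.
have /msubsetP/(_ i) hai := ha.
by have := hc i; rewrite msetE2 leq_subRL.
Qed.

Lemma formal_mul1 : left_id (mono mset0) formal_mul.
Proof.
move=> f; apply/funext => nu; rewrite mulE.
rewrite (big_fsetD1 mset0) /=; last by rewrite in_dv msub0set.
rewrite /mono eqxx mul1r msetB0 big_seq big1 ?addr0 // => mu.
by rewrite !inE => /andP[/negbTE-> _]; rewrite mul0r.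
Qed.

Lemma formal_mulDl : left_distributive formal_mul +%R.
Proof.
move=> f g h; apply/funext => nu; rewrite -[RHS]/(_ + _) !mulE -big_split /=.
by apply: eq_bigr => mu _; rewrite -mulrDl.
Qed.

Lemma formal_1neq0 : mono mset0 != 0.
Proof.
by apply/eqP => /(congr1 (fun f : formal => f mset0)) /eqP; rewrite /mono eqxx oner_eq0.
Qed.

Lemma formal_scaleAl (c : rat) (f g : formal) :
  c *: formal_mul f g = formal_mul (c *: f) g.
Proof.
apply/funext => nu; rewrite -[LHS]/(c * _) !mulE big_distrr /=.
by apply: eq_bigr => mu _; rewrite mulrA.
Qed.

End RingAxioms.

HB.instance Definition _ := GRing.Zmodule_isComNzRing.Build formal
  formal_mulA formal_mulC formal_mul1 formal_mulDl formal_1neq0.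
HB.instance Definition _ := GRing.Lmodule_isLalgebra.Build rat formal
  formal_scaleAl.
HB.instance Definition _ := GRing.Lalgebra_isComAlgebra.Build rat formal.

(** binomial(c, i) for a rational c *)
Definition rbinom (c : rat) (i : nat) : rat :=
  (\prod_(t < i) (c - t%:R)) / (i`!)%:R.

(** The coefficient of u^j in ((1 + u) / (1 - u))^c. *)
Definition kcoef (c : rat) (j : nat) : rat :=
  \sum_(i < j.+1) rbinom c i * (rbinom (- c) (j - i) * (-1) ^+ (j - i)).

(** The factor ((1 + z x^mu) / (1 - z x^mu))^c, truncated above z^n. *)
Definition kfactor (n : nat) (c : rat) (mu : monom) : {poly formal} :=
  \poly_(j < n.+1) (kcoef c j *: mono mu ^+ j).

(** The coefficient of z^n in prod_mu ((1 + z x^mu) / (1 - z x^mu))^(P mu).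
    The factors whose mu does not divide nu do not contribute to x^nu, which
    makes the infinite product well defined, including when P has infinitely
    many terms. *)
Definition qn (n : nat) (P : formal) : formal := fun nu =>
  (\big[*%R/1]_(mu \in mdivs nu) kfactor n (P mu) mu)`_n nu.

Definition pleth (z : int) (P : formal) : formal :=
  if z is Posz n then qn n P else 0.

(** A itself, as the formal sum of its variables *)
Definition alphabet : formal := fun nu =>
  (`[< exists i : nat, nu = msetn 1 i >])%:R.

Definition q (z : int) : formal := pleth z alphabet.

(** The ring Q[q_1, q_2, ...] *)
Definition Gamma : set formal :=
  smallest [set S : set formal | GRing.subalg_closed (mem S)] (range q).

Definition Qpair (r s : int) : formal :=
  q r * q s + 2 * (if s is Posz t then
    \sum_(1 <= i < t.+1) (-1) ^+ i * (q (r + i%:Z) * q (s - i%:Z)) else 0).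

Fact even_index (h : nat) (i : 'I_h) : (i.*2 < h.*2)%N.
Proof. by rewrite ltn_double. Qed.

Fact odd_index (h : nat) (i : 'I_h) : (i.*2.+1 < h.*2)%N.
Proof. by rewrite -doubleS leq_double. Qed.

Definition Pfaffian (h : nat) (M : 'M[formal]_(h.*2)) : formal :=
  (2 ^+ h * (h`!)%:R : rat)^-1 *:
    \sum_(s : 'S_(h.*2)) (-1) ^+ s *
      \prod_(i < h) M (s (Ordinal (even_index i))) (s (Ordinal (odd_index i))).

(** For an odd number of parts the default value of [nth] supplies the
    additional part 0. *)
Definition Q (lam : seq int) : formal :=
  @Pfaffian (uphalf (size lam)) (\matrix_(i, j)
    if (i < j)%N then Qpair lam`_i lam`_j
    else if (j < i)%N then - Qpair lam`_j lam`_i else 0).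

Definition strict_partition (lam : seq nat) : bool :=
  sorted geq lam && uniq [seq x <- lam | x != 0%N].

Definition Qs (lam : seq nat) : formal := Q [seq Posz x | x <- lam].

(** [index] counts from 0, hence the two successors in the exponent i + 1;
    [rem k] deletes the only part equal to k. *)
Definition is_D (k : nat) (D : formal -> formal) : Prop :=
  [/\ forall f, Gamma f -> Gamma (D f),
      forall (c : rat) f g, Gamma f -> Gamma g -> D (c *: f + g) = c *: D f + D g
    & forall lam, strict_partition lam ->
        D (Qs lam) = if k \in lam
          then (-1) ^+ (index k lam).+2 * 2 * Qs (rem k lam) else 0].

(** As the Q_lam with lam strict form a basis of Gamma, [is_D k] determines
    an operator on Gamma; the values outside Gamma are irrelevant. *)
Definition D (k : nat) : formal -> formal := xget (fun=> 0) [set E | is_D k E].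

Definition isum (m : nat) (I : 'rV[int]_m) : int := \sum_(s < m) I ord0 s.

(** The dot product with delta = (1, 2, ..., m) *)
Definition dot_delta (m : nat) (I : 'rV[int]_m) : int :=
  \sum_(s < m) I ord0 s * (s.+1)%:Z.

(* Main.v *)
Require Import Defs.
From HB Require Import structures.
From mathcomp Require Import all_boot all_order all_algebra all_fingroup.
From mathcomp Require Import finmap multiset.
From mathcomp Require Import all_classical.
From mathcomp Require Import zify ring.

Set Implicit Arguments.
Unset Strict Implicit.
Unset Printing Implicit Defensive.

Import Order.TTheory GRing.Theory Num.Theory.
Local Open Scope classical_set_scope.
Local Open Scope ring_scope.

(** The operator D_k is a coefficient of a vertex operator.  Adjoining one more
    variable x to the alphabet is a ring morphism [addvar]; it sends f in Gamma
    to a polynomial in x with coefficients f_j in Gamma, and q_r to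
    q_r + 2 sum_(j >= 1) x^j q_(r - j).  Put
      V_z f = sum_j (-1)^(z + j) q_(z + j) f_j        ([vertex z f]).
    Then D_k = V_(-k) on Gamma ([D_vertex]), and the theorem is the computation
    of V_(-k) on a plethysm.

    The computation.  The series kappa(P) = sum_n q_n(P) z^n turns sums into
    products, and adjoining x to the monomials of P = P_0 + x P_1 + ... replaces
    kappa(P) by the product of the kappa(P_s) with z scaled by x^s
    ([addvar_kappa]).  As q_m becomes q_m + 2 sum_s x^s q_(m - s), the series
    kappa(q_m) becomes kappa(q_m) times the product over 1 <= s <= m of the
    squares of the scaled kappa(q_(m - s)) ([addvar_kappa_q]).  The two factors
    of each square are indexed by i_s and j_s in the statement, and the
    exponent of x is (I + J).delta.  All these properties of kappa follow from
    its logarithmic derivative,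
      z d/dz log kappa(P) = 2 sum_(i odd) psi_i(P) z^i,
    where psi_i raises the variables to the i-th power ([has_dlog_kappa]),
    because a series with constant term 1 is determined by its logarithmic
    derivative ([has_dlog_uniq]).  The same identity, read as a recursion for
    the coefficients, shows that q_n o q_m belongs to Gamma ([Gamma_pleth]).

    Why D_k = V_(-k).  Let Qv(l) be obtained from 1 by applying
    (-1)^r V_r for the parts r of the list l, the last part first.
    Adjoining x adds to Qv(l) a signed sum over the parts of l: the part r is
    deleted and the factor q_r(A, x) - q_r(A) appears ([addvar_Qv]).  Since
    sum_j (-1)^j q_j q_(n - j) = 0 for n > 0, it follows that V_(-k) deletes the
    part k and multiplies by 2 with the sign of D_k ([vertex_Qv_strict]).  It
    also follows that Qv satisfies a recursion in which the first part is paired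
    with each of the others ([Qv_cons]); this is the expansion of a Pfaffian
    along its first row, so Qv(l) = Q_l ([Qs_Qv]).  Finally an operator on Gamma
    is determined by its values on the Q_l with l strict, because these span
    Gamma ([Gamma_span]): Qv is antisymmetric in its parts, and the recursion
    expresses q_r Qv(l) by induction on the sum of l. *)

(** * Power series in one variable *)

Definition fps (R : Type) := nat -> R.

HB.instance Definition _ (R : Type) := gen_eqMixin (fps R).
HB.instance Definition _ (R : Type) := gen_choiceMixin (fps R).
HB.instance Definition _ (R : comNzRingType) :=
  GRing.Zmodule.copy (fps R) (nat -> R).

Section FpsRing.
Variable R : comNzRingType.
Implicit Types f g h : fps R.

Definition fps_trunc N f : {poly R} := \poly_(i < N) f i.

Definition fps_mul f g : fps R := fun n => \sum_(i < n.+1) f i * g (n - i)%N.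

Definition fps_one : fps R := fun n => (n == 0%N)%:R.

(** The ring laws of power series are inherited from polynomials, since each
    coefficient of a product depends on finitely many coefficients only. *)
Lemma fps_mul_trunc N f g n : (n < N)%N ->
  (fps_trunc N f * fps_trunc N g)`_n = fps_mul f g n.
Proof.
move=> lt_nN; rewrite coefM; apply: eq_bigr => i _.
by rewrite !coef_poly (leq_ltn_trans _ lt_nN) ?leq_ord // (leq_ltn_trans _ lt_nN) ?leq_subr.
Qed.

Lemma coefM_eq N (p p' r r' : {poly R}) :
    (forall i, (i < N)%N -> p`_i = p'`_i) -> (forall i, (i < N)%N -> r`_i = r'`_i) ->
  forall i, (i < N)%N -> (p * r)`_i = (p' * r')`_i.
Proof.
move=> pE rE i lt_iN; rewrite !coefM; apply: eq_bigr => j _.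
by rewrite pE ?rE // (leq_ltn_trans _ lt_iN) ?leq_ord ?leq_subr.
Qed.

Lemma fps_truncM N f g i : (i < N)%N ->
  (fps_trunc N (fps_mul f g))`_i = (fps_trunc N f * fps_trunc N g)`_i.
Proof. by move=> lt_iN; rewrite coef_poly lt_iN fps_mul_trunc. Qed.

Lemma fps_mulC : commutative fps_mul.
Proof.
move=> f g; apply/funext => n.
by rewrite -!(@fps_mul_trunc n.+1) // mulrC.
Qed.

Lemma fps_mulA : associative fps_mul.
Proof.
move=> f g h; apply/funext => n; rewrite -!(@fps_mul_trunc n.+1) //.
rewrite (@coefM_eq n.+1 _ (fps_trunc n.+1 f) _ (fps_trunc n.+1 g * fps_trunc n.+1 h)) //;
  last exact: fps_truncM.
by rewrite mulrA; apply/esym/(@coefM_eq n.+1) => //; exact: fps_truncM.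
Qed.

Lemma fps_mul1 : left_id fps_one fps_mul.
Proof.
move=> f; apply/funext => n; rewrite /fps_mul big_ord_recl /= mul1r subn0.
by rewrite big1 ?addr0 // => i _; rewrite mul0r.
Qed.

Lemma fps_mulDl : left_distributive fps_mul +%R.
Proof.
move=> f g h; apply/funext => n; rewrite -[RHS]/(_ + _) -big_split /=.
by apply: eq_bigr => i _; rewrite -mulrDl.
Qed.

Lemma fps_1neq0 : fps_one != 0.
Proof. by apply/eqP => /(congr1 (fun f : fps R => f 0%N)) /eqP; rewrite oner_eq0. Qed.

End FpsRing.

HB.instance Definition _ (R : comNzRingType) := GRing.Zmodule_isComNzRing.Build (fps R)
  (@fps_mulA R) (@fps_mulC R) (@fps_mul1 R) (@fps_mulDl R) (@fps_1neq0 R).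

Section FpsTheory.
Variable R : comNzRingType.
Implicit Types f g h : fps R.

Lemma fpsM f g n : (f * g) n = \sum_(i < n.+1) f i * g (n - i)%N.
Proof. by []. Qed.
Lemma fps1 n : (1 : fps R) n = (n == 0%N)%:R.
Proof. by []. Qed.
Lemma fpsD f g n : (f + g) n = f n + g n.
Proof. by []. Qed.
Lemma fpsN f n : (- f) n = - f n.
Proof. by []. Qed.

Lemma fps_sum I (r : seq I) P (F : I -> fps R) n :
  (\sum_(i <- r | P i) F i) n = \sum_(i <- r | P i) F i n.
Proof. by rewrite (big_morph (fun f : fps R => f n) (id1 := 0) (op1 := +%R)). Qed.

Lemma fpsMn f k n : (f *+ k) n = f n *+ k.
Proof. by elim: k => // k IHk; rewrite !mulrS -IHk. Qed.

Definition fps_cst (c : R) : fps R := fun n => if n is 0%N then c else 0.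
Definition fps_mono (d : nat) : fps R := fun n => (n == d)%:R.
(** The substitution z -> y z. *)
Definition fps_scale (y : R) f : fps R := fun n => y ^+ n * f n.
(** The derivation z d/dz: it has the same use as d/dz and does not shift the
    coefficients. *)
Definition theta f : fps R := fun n => f n *+ n.

Lemma fps_cstM c f n : (fps_cst c * f) n = c * f n.
Proof.
rewrite fpsM big_ord_recl /= subn0 big1 ?addr0 // => i _; exact: mul0r.
Qed.

Lemma fps_cst_is_zmod_morphism : zmod_morphism fps_cst.
Proof. by move=> a b; apply/funext; case=> [|n] //=; rewrite -[RHS]/(_ - _) subr0. Qed.

Lemma fps_cst_is_monoid_morphism : monoid_morphism fps_cst.
Proof.
split=> [|a b]; first by apply/funext; case.
by apply/funext => n; rewrite fps_cstM; case: n => [|n] //=; rewrite mulr0.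
Qed.

HB.instance Definition _ := GRing.isZmodMorphism.Build R (fps R) fps_cst
  fps_cst_is_zmod_morphism.
HB.instance Definition _ := GRing.isMonoidMorphism.Build R (fps R) fps_cst
  fps_cst_is_monoid_morphism.

Lemma fps_monoM d f n : (fps_mono d * f) n = if (d <= n)%N then f (n - d)%N else 0.
Proof.
rewrite fpsM; case: leqP => [le_dn|lt_nd]; last first.
  rewrite big1 // => i _; rewrite /fps_mono ltn_eqF ?mul0r //.
  by rewrite (leq_ltn_trans _ lt_nd) ?leq_ord.
rewrite (bigD1 (Ordinal (le_dn : (d < n.+1)%N))) //= /fps_mono eqxx mul1r.
rewrite big1 ?addr0 // => i /eqP/val_eqP/= /negPf ->; exact: mul0r.
Qed.

Lemma fps_monoD d e : fps_mono (d + e) = fps_mono d * fps_mono e.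
Proof.
apply/funext => n; rewrite fps_monoM /fps_mono; case: leqP => h.
  by rewrite -[X in X == _](subnKC h) eqn_add2l.
by rewrite ltn_eqF // (leq_trans h) // leq_addr.
Qed.

Lemma fps_mono0 : fps_mono 0 = 1.
Proof. by []. Qed.

Lemma fps_monoX d n : fps_mono d ^+ n = fps_mono (d * n).
Proof. by elim: n => [|n IHn]; rewrite ?muln0 // exprS IHn -fps_monoD mulnS. Qed.

Lemma fps_scale_is_zmod_morphism y : zmod_morphism (fps_scale y).
Proof. by move=> f g; apply/funext => n; rewrite /fps_scale -[RHS]/(_ - _) -mulrBr. Qed.

Lemma fps_scale_is_monoid_morphism y : monoid_morphism (fps_scale y).
Proof.
split=> [|f g]; apply/funext => n.
  by rewrite /fps_scale fps1; case: n => [|n]; rewrite ?mulr0 ?mulr1.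
rewrite fpsM /fps_scale fpsM big_distrr /=; apply: eq_bigr => i _.
by rewrite mulrACA -exprD subnKC ?leq_ord.
Qed.

HB.instance Definition _ y := GRing.isZmodMorphism.Build (fps R) (fps R) (fps_scale y)
  (fps_scale_is_zmod_morphism y).
HB.instance Definition _ y := GRing.isMonoidMorphism.Build (fps R) (fps R) (fps_scale y)
  (fps_scale_is_monoid_morphism y).

Lemma theta_scale y f : theta (fps_scale y f) = fps_scale y (theta f).
Proof. by apply/funext => n; rewrite /theta /fps_scale mulrnAr. Qed.

Lemma thetaM f g : theta (f * g) = theta f * g + f * theta g.
Proof.
apply/funext => n; rewrite fpsD !fpsM -big_split /= /theta fpsM -sumrMnl.
by apply: eq_bigr => i _; rewrite mulrnAl mulrnAr -mulrnDr subnKC ?leq_ord.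
Qed.

Lemma theta1 : theta 1 = 0.
Proof. by apply/funext; case=> [|n]; rewrite /theta fps1 ?mulr0n ?mul0rn. Qed.

(** [a] is the logarithmic derivative theta h / h of a series h with constant
    term 1; written without a quotient, it is a recursion for the coefficients
    of h. *)
Definition has_dlog (a h : fps R) := h 0%N = 1 /\ theta h = a * h.

Lemma has_dlog1 : has_dlog 0 1.
Proof. by split; rewrite ?theta1 ?mul0r. Qed.

Lemma has_dlogM a b g h : has_dlog a g -> has_dlog b h -> has_dlog (a + b) (g * h).
Proof.
move=> [g0 gE] [h0 hE]; split; first by rewrite fpsM big_ord1 g0 h0 mulr1.
by rewrite thetaM gE hE; ring.
Qed.

Lemma has_dlog_prod I (r : seq I) (a h : I -> fps R) :
    (forall i, has_dlog (a i) (h i)) ->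
  has_dlog (\sum_(i <- r) a i) (\prod_(i <- r) h i).
Proof.
move=> ah; elim: r => [|i r IHr]; rewrite ?big_nil ?big_cons; first exact: has_dlog1.
exact: has_dlogM.
Qed.

Lemma has_dlog_scale y a h : has_dlog a h -> has_dlog (fps_scale y a) (fps_scale y h).
Proof.
move=> [h0 hE]; split; first by rewrite /fps_scale h0 mulr1.
by rewrite theta_scale hE rmorphM.
Qed.

(** The coefficient of z^n in theta h = a h expresses n h_n by the earlier
    coefficients of h. *)
Lemma has_dlog_uniq a g h : (forall (x : R) n, x *+ n.+1 = 0 -> x = 0) ->
  a 0%N = 0 -> has_dlog a g -> has_dlog a h -> g = h.
Proof.
move=> tf a0 [g0 gE] [h0 hE]; apply/funext => n.
elim/ltn_ind: n => -[|n] IHn; first by rewrite g0 h0.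
apply/eqP; rewrite -subr_eq0; apply/eqP/(tf _ n); rewrite mulrnBl; apply/eqP.
rewrite subr_eq0 -[_ *+ _]/(theta g n.+1) -[h _ *+ _]/(theta h n.+1) gE hE !fpsM.
rewrite big_ord_recl [X in _ == X]big_ord_recl /= a0 !mul0r !add0r.
by apply/eqP/eq_bigr => i _; rewrite IHn // subSS ltnS leq_subr.
Qed.

End FpsTheory.

Section FpsMap.
Variables (R S : comNzRingType) (u : {rmorphism R -> S}).

Definition fps_map (f : fps R) : fps S := fun n => u (f n).

Lemma fps_map_is_zmod_morphism : zmod_morphism fps_map.
Proof. by move=> f g; apply/funext => n; rewrite /fps_map -[RHS]/(_ - _) -rmorphB. Qed.

Lemma fps_map_is_monoid_morphism : monoid_morphism fps_map.
Proof.
split=> [|f g]; apply/funext => n; first by rewrite /fps_map !fps1 rmorph_nat.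
by rewrite /fps_map !fpsM rmorph_sum; apply: eq_bigr => i _; rewrite rmorphM.
Qed.

HB.instance Definition _ := GRing.isZmodMorphism.Build (fps R) (fps S) fps_map
  fps_map_is_zmod_morphism.
HB.instance Definition _ := GRing.isMonoidMorphism.Build (fps R) (fps S) fps_map
  fps_map_is_monoid_morphism.

Lemma theta_map f : theta (fps_map f) = fps_map (theta f).
Proof. by apply/funext => n; rewrite /theta /fps_map rmorphMn. Qed.

Lemma has_dlog_map a h : has_dlog a h -> has_dlog (fps_map a) (fps_map h).
Proof.
move=> [h0 hE]; split; first by rewrite /fps_map h0 rmorph1.
by rewrite theta_map hE rmorphM.
Qed.

End FpsMap.


(** * Monomials: dilation by a scalar, and one more variable *)

Definition mdivisors (nu : monom) : {fset monom}%fset := fset_set (mdivs nu).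

Lemma in_mdivisors (nu mu : monom) : (mu \in mdivisors nu) = msubset mu nu.
Proof.
rewrite in_fset_set; last exact: finite_mdivs.
by apply/idP/idP => [/set_mem//|h]; apply/mem_set.
Qed.

Lemma monomP (mu nu : monom) : (forall i, mu i = nu i) <-> mu = nu.
Proof. by split=> [h|-> //]; apply/fsfunP. Qed.

Definition mmul (j : nat) (mu : monom) : monom := iter j (msetD mu) mset0.

Lemma mmulE j mu i : mmul j mu i = (j * mu i)%N.
Proof. by elim: j => [|j IHj] /=; rewrite ?mset0E // msetE2 IHj mulSn. Qed.

Definition mdiv (j : nat) (nu : monom) : monom :=
  [fsfun i in finsupp nu => (nu i %/ j)%N]%fset.

Lemma mdivE j nu i : mdiv j nu i = (nu i %/ j)%N.
Proof.
rewrite /mdiv fsfunE; case: ifPn => // h.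
by rewrite fsfun_dflt // div0n.
Qed.

Lemma mdivK j mu : (0 < j)%N -> mdiv j (mmul j mu) = mu.
Proof. by move=> j0; apply/monomP => i; rewrite mdivE mmulE mulKn. Qed.

Lemma mmul_inj j : (0 < j)%N -> injective (mmul j).
Proof. by move=> j0; apply: can_inj (mdiv j) _ => mu; exact: mdivK. Qed.

Lemma mmulDr j mu nu : mmul j (msetD mu nu) = msetD (mmul j mu) (mmul j nu).
Proof. by apply/monomP => i; rewrite !(mmulE, msetE2) mulnDr. Qed.

Lemma mmulBr j mu nu : mmul j (msetB mu nu) = msetB (mmul j mu) (mmul j nu).
Proof. by apply/monomP => i; rewrite !(mmulE, msetE2) mulnBr. Qed.

Lemma msubset_mmul j mu : (0 < j)%N -> msubset mu (mmul j mu).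
Proof. by move=> j0; apply/msubsetP => i; rewrite mmulE leq_pmull. Qed.

Lemma msubset_mmul2 j mu nu : (0 < j)%N -> msubset (mmul j mu) (mmul j nu) = msubset mu nu.
Proof.
move=> j0; apply/msubsetP/msubsetP => h i; have := h i; rewrite !mmulE.
  by rewrite leq_pmul2l.
by rewrite leq_pmul2l.
Qed.

(** The variables of [nu] are renumbered to leave the number 0 to a new
    variable, which gets the exponent [j]. *)
Definition mcons (nu : monom) (j : nat) : monom :=
  [fsfun i in (0%N |` [fset i.+1 | i in finsupp nu])%fset
     => if i is i'.+1 then nu i' else j]%fset.

Lemma mconsE nu j i : mcons nu j i = if i is i'.+1 then nu i' else j.
Proof.
rewrite /mcons fsfunE; case: ifPn => //; case: i => [|i]; first by rewrite !inE.
rewrite !inE /= => h; rewrite fsfun_dflt //; apply: contra h => h.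
by apply/imfsetP; exists i.
Qed.

Definition mbehead (mu : monom) : monom := [fsfun i in [fset i.-1 | i in finsupp mu]%fset =>
  mu i.+1]%fset.

Lemma mbeheadE mu i : mbehead mu i = mu i.+1.
Proof.
rewrite /mbehead fsfunE; case: ifPn => // h; rewrite fsfun_dflt //.
by apply: contra h => h; apply/imfsetP; exists i.+1.
Qed.

Lemma mcons_mbehead mu : mcons (mbehead mu) (mu 0%N) = mu.
Proof. by apply/monomP => -[|i]; rewrite mconsE ?mbeheadE. Qed.

Lemma mcons_inj mu nu i j : mcons mu i = mcons nu j -> mu = nu /\ i = j.
Proof.
move=> h; split; last by move: (congr1 (fun m : monom => m 0%N) h); rewrite !mconsE.
by apply/monomP => l; move: (congr1 (fun m : monom => m l.+1) h); rewrite !mconsE.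
Qed.

Lemma msubset_mcons mu nu i j : msubset (mcons mu i) (mcons nu j) = (i <= j)%N && msubset mu nu.
Proof.
apply/msubsetP/andP => [h|[ij /msubsetP h] [|l]]; rewrite ?mconsE //.
split; first by have := h 0%N; rewrite !mconsE.
by apply/msubsetP => l; have := h l.+1; rewrite !mconsE.
Qed.

Lemma msetB_mcons mu nu i j : msetB (mcons nu j) (mcons mu i) = mcons (msetB nu mu) (j - i).
Proof. by apply/monomP => -[|l]; rewrite !(mconsE, msetE2). Qed.

Lemma mmul_mcons c mu j : mmul c (mcons mu j) = mcons (mmul c mu) (c * j).
Proof. by apply/monomP => -[|l]; rewrite !(mconsE, mmulE). Qed.

(** * The ring of formal sums of monomials *)

Section FormalSums.
Implicit Types f g P : formal.

Lemma formalM f g nu :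
  (f * g) nu = \sum_(mu <- mdivisors nu) (f mu : rat) * (g (msetB nu mu) : rat).
Proof.
rewrite -[LHS]/(formal_mul f g nu) /formal_mul fsbig_finite //.
exact: finite_mdivs.
Qed.

Lemma formalD f g nu : (f + g) nu = f nu + g nu.
Proof. by []. Qed.
Lemma formalZ (c : rat) f nu : (c *: f) nu = c * f nu.
Proof. by []. Qed.
Lemma formal_sum I (r : seq I) Q (F : I -> formal) nu :
  (\sum_(i <- r | Q i) F i) nu = \sum_(i <- r | Q i) F i nu.
Proof. by rewrite (big_morph (fun f : formal => f nu) (id1 := 0) (op1 := +%R)). Qed.
Lemma formalMn f k nu : (f *+ k) nu = f nu *+ k.
Proof. by elim: k => // k IHk; rewrite !mulrS formalD IHk. Qed.
Lemma formal1 nu : (1 : formal) nu = (nu == mset0)%:R.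
Proof. by []. Qed.

Lemma formal_torsion_free f n : f *+ n.+1 = 0 -> f = 0.
Proof.
move=> h; apply/funext => nu; have := congr1 (fun g : formal => g nu) h.
by rewrite formalMn => /eqP; rewrite mulrn_eq0 /= => /eqP.
Qed.

Lemma fps_torsion_free (R : comNzRingType) :
  (forall (x : R) n, x *+ n.+1 = 0 -> x = 0) ->
  forall (x : fps R) n, x *+ n.+1 = 0 -> x = 0.
Proof.
move=> tf x n h; apply/funext => i; have := congr1 (fun g : fps R => g i) h.
by rewrite fpsMn => /tf.
Qed.

Lemma mono0 : mono mset0 = 1.
Proof. by []. Qed.

Lemma monoD mu nu : mono (msetD mu nu) = mono mu * mono nu.
Proof.
apply/funext => rho; rewrite formalM /mono; case: (boolP (msubset mu rho)) => h; last first.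
  rewrite big_seq big1 => [|x]; last first.
    by rewrite in_mdivisors; case: eqVneq => [->|_]; rewrite ?(negPf h) ?mul0r.
  case: eqVneq => // e; case/negP: h; rewrite e; apply/msubsetP => i.
  by rewrite msetE2 leq_addr.
rewrite (big_fsetD1 mu) ?in_mdivisors //= eqxx mul1r big_seq big1 ?addr0; last first.
  by move=> x; rewrite !inE => /andP[/negPf-> _]; rewrite mul0r.
congr (_%:R); congr nat_of_bool; apply/eqP/eqP => [->|<-].
  by rewrite msetDKB.
by rewrite msetBDKC.
Qed.

Lemma monoX mu j : mono mu ^+ j = mono (mmul j mu).
Proof. by elim: j => [|j IHj]; rewrite ?mono0 // exprS IHj -monoD. Qed.

(** * Adams operations *)

(** The substitution of a^j for each variable a. *)
Definition adams (j : nat) P : formal := fun nu =>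
  if nu == mmul j (mdiv j nu) then P (mdiv j nu) else 0.

Lemma adams_mmul j P mu : (0 < j)%N -> adams j P (mmul j mu) = P mu.
Proof. by move=> j0; rewrite /adams mdivK // eqxx. Qed.

Lemma adams_notin j P nu : (forall mu, nu <> mmul j mu) -> adams j P nu = 0.
Proof. by move=> h; rewrite /adams; case: eqP => // /h. Qed.

(** As a linear combination of monomials; the sum may range over the divisors
    of any multiple of [nu], because the only contributing mu divides [nu]. *)
Lemma adams_sum j P nu rho : (0 < j)%N -> msubset nu rho ->
  adams j P nu = \sum_(mu <- mdivisors rho) (P mu : rat) * (nu == mmul j mu)%:R.
Proof.
move=> j0 sub; have [[mu numu]|no] := pselect (exists mu, nu = mmul j mu).
  have in_mu : mu \in mdivisors rho.
    by rewrite in_mdivisors (msubset_trans _ sub) // numu msubset_mmul.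
  rewrite (big_fsetD1 mu in_mu) /= numu adams_mmul // eqxx mulr1.
  rewrite big_seq big1 ?addr0 // => x; rewrite !inE => /andP[/negPf ne _].
  by rewrite (inj_eq (mmul_inj j0)) eq_sym ne mulr0.
rewrite adams_notin => [|mu h]; last by apply: no; exists mu.
by rewrite big1 // => mu _; case: eqP => [h|_]; rewrite ?mulr0 //; case: no; exists mu.
Qed.

Lemma adamsD j : {morph adams j : f g / f + g}.
Proof.
move=> f g; apply/funext => nu; by rewrite formalD /adams; case: ifP.
Qed.

Lemma adamsZ j c f : adams j (c *: f) = c *: adams j f.
Proof.
apply/funext => nu; rewrite formalZ /adams; case: ifP => // _.
by rewrite mulr0.
Qed.

Lemma adams0 j : adams j 0 = 0.
Proof. by rewrite -(scale0r 0) adamsZ scale0r. Qed.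

Lemma adams1 j : (0 < j)%N -> adams j 1 = 1.
Proof.
move=> j0; apply/funext => nu; rewrite formal1 /adams formal1.
case: (eqVneq nu mset0) => [->|ne].
  have e : mdiv j mset0 = mset0 by apply/monomP => i; rewrite mdivE mset0E div0n.
  have -> : mmul j (mdiv j mset0) = mset0.
    by apply/monomP => i; rewrite mmulE e mset0E muln0.
  by rewrite e !eqxx.
case: ifP => // /eqP e; case: eqVneq => // e2; case/eqP: ne; rewrite e e2.
by apply/monomP => i; rewrite mmulE !mset0E muln0.
Qed.

Lemma adamsM j : (0 < j)%N -> {morph adams j : f g / f * g}.
Proof.
move=> j0 f g; apply/funext => nu; rewrite formalM.
have [[mu numu]|no] := pselect (exists mu, nu = mmul j mu); last first.
  rewrite adams_notin => [|mu h]; last by apply: no; exists mu.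
  rewrite big_seq big1 // => x; rewrite in_mdivisors => sub.
  have [[y xy]|nox] := pselect (exists y, x = mmul j y); last first.
    by rewrite adams_notin ?mul0r // => y h; apply: nox; exists y.
  rewrite [X in _ * X]adams_notin ?mulr0 // => z h; apply: no.
  by exists (msetD y z); rewrite mmulDr -xy -h msetBDKC.
rewrite numu adams_mmul // formalM.
rewrite [RHS](bigID (mem [fset mmul j x | x in mdivisors mu]%fset)) /=.
rewrite [X in _ + X]big1_seq ?addr0; last first.
  move=> x /andP[nin]; rewrite in_mdivisors => sub.
  rewrite adams_notin ?mul0r // => y h; case/negP: nin; apply/imfsetP; exists y => //=.
  by rewrite in_mdivisors -(msubset_mmul2 _ _ j0) -h.
rewrite -[RHS]big_filter [RHS](perm_big (enum_fset [fset mmul j x | x in mdivisors mu]%fset))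
  /=; last first.
  apply: uniq_perm; rewrite ?filter_uniq ?fset_uniq // => x; rewrite mem_filter.
  apply/andP/idP => [[]//|h]; split=> //; case/imfsetP: h => y /= + ->.
  by rewrite !in_mdivisors msubset_mmul2.
rewrite [RHS]big_imfset /=; last by move=> x y _ _; exact: mmul_inj.
by apply: eq_bigr => x _; rewrite -mmulBr !adams_mmul.
Qed.

Lemma adams_adams i j f : (0 < i)%N -> (0 < j)%N -> adams i (adams j f) = adams (i * j) f.
Proof.
move=> i0 j0; have ij0 : (0 < i * j)%N by rewrite muln_gt0 i0.
have mm mu : mmul i (mmul j mu) = mmul (i * j) mu.
  by apply/monomP => l; rewrite !mmulE mulnA.
apply/funext => nu.
have [[mu ->]|no] := pselect (exists mu, nu = mmul (i * j) mu).
  by rewrite adams_mmul // -mm !adams_mmul.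
rewrite [RHS]adams_notin => [|mu h]; last by apply: no; exists mu.
rewrite {1}/adams; case: eqP => // e; rewrite adams_notin // => mu h.
by apply: no; exists mu; rewrite -mm -h.
Qed.

(** * Adjoining a variable to the alphabet *)

(** By symmetry of the elements of Gamma, renumbering the variables does not
    matter, and [addvar f j] is the coefficient of x^j in f(A, x). *)
Definition addvar f : fps formal := fun j nu => f (mcons nu j).

Lemma addvar_is_zmod_morphism : zmod_morphism addvar.
Proof. by []. Qed.

Lemma addvarZ (c : rat) f j : addvar (c *: f) j = c *: addvar f j.
Proof. by []. Qed.

Lemma addvar1 : addvar 1 = 1.
Proof.
apply/funext => j; apply/funext => nu; rewrite /addvar formal1 fps1.
have e0 : mset0 = mcons mset0 0 by apply/monomP => -[|i]; rewrite mconsE !mset0E.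
case: j => [|j].
  rewrite eqxx mulr1n formal1; congr (_%:R); congr nat_of_bool.
  by rewrite [in LHS]e0; apply/eqP/eqP => [/mcons_inj[]|->].
by rewrite [in LHS]e0; case: eqP => // /mcons_inj[].
Qed.

Lemma addvarM f g : addvar (f * g) = addvar f * addvar g.
Proof.
apply/funext => j; apply/funext => nu; rewrite fpsM /addvar formalM formal_sum.
under [RHS]eq_bigr => i _ do rewrite formalM.
pose Fx (x : monom) : rat := (f x : rat) * (g (msetB (mcons nu j) x) : rat).
transitivity (\sum_(x <- [seq mcons mu i | i <- index_iota 0 j.+1, mu <- mdivisors nu]) Fx x).
  apply: perm_big; apply: uniq_perm; first exact: fset_uniq.
    by apply: allpairs_uniq;
      rewrite ?iota_uniq ?fset_uniq // => -[a b] [c d] _ _ /mcons_inj[/= -> ->].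
  move=> x; rewrite in_mdivisors; apply/idP/allpairsP => [|[[i mu] [/[!mem_index_iota]]]].
    rewrite -{1}(mcons_mbehead x) msubset_mcons => /andP[xj xnu]; exists (x 0%N, mbehead x).
    by split; rewrite ?mem_index_iota ?in_mdivisors ?mcons_mbehead.
  by rewrite in_mdivisors => /andP[_ ij] munu ->; rewrite msubset_mcons munu andbT.
rewrite big_allpairs_dep big_mkord.
apply: eq_bigr => i _; apply: eq_bigr => mu _.
by rewrite /Fx msetB_mcons.
Qed.

HB.instance Definition _ := GRing.isZmodMorphism.Build formal (fps formal) addvar
  addvar_is_zmod_morphism.
HB.instance Definition _ := GRing.isMonoidMorphism.Build formal (fps formal) addvar
  (conj addvar1 addvarM).

Lemma addvar_adams i f j : (0 < i)%N ->
  addvar (adams i f) j = if (i %| j)%N then adams i (addvar f (j %/ i)%N) else 0.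
Proof.
move=> i0; apply/funext => nu; rewrite {1}/addvar.
have [[mu e]|no] := pselect (exists mu, mcons nu j = mmul i mu).
  rewrite e adams_mmul //; move: e; rewrite -(mcons_mbehead mu) mmul_mcons => /mcons_inj[-> ->].
  by rewrite dvdn_mulr // mulKn // adams_mmul.
rewrite adams_notin => [|mu h]; last by apply: no; exists mu.
case: dvdnP => // -[d jE]; rewrite adams_notin // => mu h; apply: no.
by exists (mcons mu d); rewrite mmul_mcons h jE mulnC.
Qed.

End FormalSums.

(** * The series of the q_n(P) and its logarithmic derivative *)

Section Odd.
Variable R : comNzRingType.

Definition fps_odd : fps R := fun n => (odd n)%:R.
Definition fps_even : fps R := fun n => (~~ odd n)%:R.

Lemma fps_oddE : fps_odd = fps_mono R 1 * fps_even.
Proof. by apply/funext; case=> [|n]; rewrite fps_monoM //= subn1 /= /fps_even. Qed.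

Lemma fps_evenV : (1 - fps_mono R 1 ^+ 2) * fps_even = 1.
Proof.
apply/funext => n; rewrite mulrBl mul1r fps_monoX fpsD fpsN fps_monoM fps1 /fps_even.
case: n => [|[|n]] /=; rewrite ?subr0 // subn2 /= negbK.
by case: (odd n); rewrite /= subrr.
Qed.

(** A logarithmic derivative c (2 z + 2 z^3 + ...) is 2 c z / (1 - z^2); the
    equation is easier to check with the denominator cleared. *)
Lemma has_dlog_odd (c : R) (h : fps R) : h 0%N = 1 ->
  (1 - fps_mono R 1 ^+ 2) * theta h = fps_cst (2 * c) * (fps_mono R 1 * h) ->
  has_dlog (fps_cst (2 * c) * fps_odd) h.
Proof.
move=> h0 hE; split=> //; rewrite fps_oddE -[LHS]mul1r -{1}fps_evenV.
by rewrite mulrAC hE; ring.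
Qed.

End Odd.

Lemma rbinomS c i : rbinom c i.+1 *+ i.+1 = (c - i%:R) * rbinom c i.
Proof.
have fne j : (j`!)%:R != 0 :> rat by rewrite pnatr_eq0 -lt0n fact_gt0.
rewrite /rbinom big_ord_recr /= factS natrM -mulr_natr.
have := fne i; have : (i.+1)%:R != 0 :> rat by rewrite pnatr_eq0.
by rewrite -natr1 addrC => h1 h2; field; rewrite h1 h2.
Qed.

(** The differential equation (1 + z) f' = c f of f = (1 + z)^c, times z. *)
Lemma theta_rbinom c :
  (1 + fps_mono _ 1) * theta (rbinom c : fps rat) =
  fps_cst c * (fps_mono _ 1 * (rbinom c : fps rat)).
Proof.
apply/funext => n; rewrite mulrDl mul1r fpsD fps_cstM !fps_monoM.
case: n => [|n] /=; first by rewrite /theta mulr0n addr0 mulr0.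
rewrite subn1 /= /theta rbinomS -mulr_natr; ring.
Qed.

(** ((1 + z) / (1 - z))^c is the product of (1 + z)^c and (1 - z)^(-c). *)
Lemma kcoefE c :
  (kcoef c : fps rat) = (rbinom c : fps rat) * fps_scale (-1) (rbinom (- c) : fps rat).
Proof. by apply/funext => n; rewrite fpsM; apply: eq_bigr => i _; congr (_ * _); rewrite mulrC. Qed.

Lemma has_dlog_kcoef c : has_dlog (fps_cst (2 * c) * fps_odd _) (kcoef c : fps rat).
Proof.
apply: has_dlog_odd.
  by rewrite /kcoef big_ord1 /rbinom !big_ord0 fact0 divr1 !mulr1.
rewrite kcoefE; set B : fps rat := rbinom c; set C := fps_scale _ _.
have hB : (1 + fps_mono _ 1) * theta B = fps_cst c * (fps_mono _ 1 * B) by exact: theta_rbinom.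
have hC : (1 - fps_mono _ 1) * theta C = fps_cst c * (fps_mono _ 1 * C).
  have sX : fps_scale (-1) (fps_mono _ 1) = - fps_mono _ 1 :> fps rat.
    apply/funext => n; rewrite fpsN /fps_scale /fps_mono.
    by case: eqP => [->|_]; rewrite ?mulr0 ?oppr0 ?expr1 ?mulr1.
  have sc a : fps_scale (-1) (fps_cst a) = fps_cst a :> fps rat.
    by apply/funext; case=> [|n]; rewrite /fps_scale /= ?mulr0 ?mul1r.
  have := congr1 (fps_scale (-1)) (theta_rbinom (- c)).
  rewrite !rmorphM rmorphD rmorph1 /= sX -theta_scale -/C sc => ->.
  by rewrite rmorphN; ring.
rewrite thetaM.
transitivity ((1 - fps_mono _ 1) * C * ((1 + fps_mono _ 1) * theta B) +
   (1 + fps_mono _ 1) * B * ((1 - fps_mono _ 1) * theta C)); first by ring.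
by rewrite hB hC rmorphM /= rmorph_nat; ring.
Qed.

(** The factor ((1 + z x^mu) / (1 - z x^mu))^c as a series in z. *)
Definition kappa_factor (c : rat) (mu : monom) : fps formal :=
  fps_scale (mono mu) (fps_map (in_alg formal) (kcoef c)).

Lemma kappa_factorE c mu n : kappa_factor c mu n = kcoef c n *: mono (mmul n mu).
Proof. by rewrite /kappa_factor /fps_scale /fps_map monoX /= mulr_algr. Qed.

Definition dlog_factor (c : rat) (mu : monom) : fps formal := fun n =>
  if odd n then (2 * c) *: mono (mmul n mu) else 0.

Lemma has_dlog_factor c mu : has_dlog (dlog_factor c mu) (kappa_factor c mu).
Proof.
have := has_dlog_scale (mono mu) (has_dlog_map (in_alg formal) (has_dlog_kcoef c)).
congr (has_dlog _ _); apply/funext => n.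
rewrite /fps_scale /fps_map fps_cstM /fps_odd monoX /= mulr_algr /dlog_factor.
by case: (odd n); rewrite ?mulr1 ?mulr0 ?scale0r.
Qed.

(** Agreement at all divisors of [nu].  This is a congruence modulo the ideal
    of the sums in which no divisor of [nu] occurs, and it makes the infinite
    product that defines q_n(P) finite. *)
Definition fcong (nu : monom) (g h : fps formal) :=
  forall n mu, msubset mu nu -> g n mu = h n mu.

Lemma fcongM nu g g' h h' : fcong nu g g' -> fcong nu h h' -> fcong nu (g * h) (g' * h').
Proof.
move=> gg hh n mu sub; rewrite !fpsM !formal_sum; apply: eq_bigr => i _.
rewrite !formalM; apply: eq_big_seq => x; rewrite in_mdivisors => xmu.
rewrite gg ?hh //; first by rewrite (msubset_trans _ sub) // msubsetDl.
exact: msubset_trans xmu sub.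
Qed.

Lemma fcong_factor nu c mu : ~~ msubset mu nu -> fcong nu (kappa_factor c mu) 1.
Proof.
move=> nsub [|n] x xnu; rewrite kappa_factorE fps1 /=.
  by rewrite /kcoef big_ord1 /rbinom !big_ord0 fact0 divr1 !mulr1 scale1r.
rewrite formalZ /mono; case: eqP => [xE|]; last by rewrite mulr0.
case/negP: nsub; apply: msubset_trans xnu; rewrite xE; exact: (@msubset_mmul n.+1).
Qed.

Definition kappa (P : formal) : fps formal := fun n => qn n P.

Lemma coef_prod_trunc (R : comNzRingType) N (I : Type) (r : seq I) (F : I -> fps R) n : (n < N)%N ->
  (\prod_(i <- r) fps_trunc N (F i))`_n = (\prod_(i <- r) F i) n.
Proof.
elim: r n => [|i r IHr] n lt_nN; first by rewrite !big_nil coef1.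
rewrite !big_cons -[RHS]/(fps_mul _ _ _) -(fps_mul_trunc _ _ lt_nN).
apply: (coefM_eq (N := N)) => // j lt_jN; rewrite IHr // coef_poly lt_jN //.
Qed.

(** A factor with mu not dividing [nu] is congruent to 1, so the product may be
    taken over any finite set that contains the divisors of [nu].  A common set
    [U] for several [nu] is what makes products of coefficients computable. *)
Lemma kappa_prod P (U : {fset monom}%fset) n nu : (mdivisors nu `<=` U)%fset ->
  kappa P n nu = (\prod_(mu <- U) kappa_factor (P mu) mu) n nu.
Proof.
move=> /fsubsetP sub; transitivity ((\prod_(mu <- mdivisors nu) kappa_factor (P mu) mu) n nu).
  rewrite /kappa /qn fsbig_finite; last exact: finite_mdivs.
  rewrite -/(mdivisors nu) -(@coef_prod_trunc _ n.+1) //; congr ((_ : {poly formal})`_n nu).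
  apply: eq_bigr => mu _; apply/polyP => j; rewrite !coef_poly; case: ifP => // _.
  by rewrite kappa_factorE monoX.
apply: (_ : fcong nu _ _) => //; last exact: msubset_refl.
have -> : \prod_(mu <- mdivisors nu) kappa_factor (P mu) mu =
          \prod_(mu <- U) if msubset mu nu then kappa_factor (P mu) mu else 1.
  rewrite -big_mkcond -[RHS]big_filter; apply: perm_big; apply: uniq_perm.
  - exact: fset_uniq.
  - by rewrite filter_uniq ?fset_uniq.
  - by move=> x; rewrite mem_filter in_mdivisors; apply/idP/andP => [h|[]//];
    rewrite h sub ?in_mdivisors.
elim/big_ind2: _ => // [g g' h h'|mu _]; first exact: fcongM.
by case: ifPn => // nsub n' x xnu; rewrite (@fcong_factor nu).
Qed.

Definition dlog_kappa (P : formal) : fps formal := fun n =>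
  if odd n then 2 *: adams n P else 0.

(** Logarithmic derivatives of the factors add up, and the sum over mu of
    P(mu) x^(i mu) is psi_i(P). *)
Lemma has_dlog_kappa P : has_dlog (dlog_kappa P) (kappa P).
Proof.
split.
  apply/funext => nu; rewrite (kappa_prod _ _ (fsubset_refl _)).
  have [-> _] := has_dlog_prod (mdivisors nu) (fun mu => has_dlog_factor (P mu) mu); by [].
apply/funext => n; apply/funext => nu; rewrite {1}/theta formalMn.
rewrite (kappa_prod _ _ (fsubset_refl _)) -formalMn.
set G := \prod_(mu <- _) _.
have [_ GE] := has_dlog_prod (mdivisors nu) (fun mu => has_dlog_factor (P mu) mu).
rewrite -[_ *+ _]/(theta G n) GE !fpsM !formal_sum; apply: eq_bigr => i _.
rewrite !formalM; apply: eq_big_seq => x; rewrite in_mdivisors => xnu.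
congr (_ * _); last first.
  apply/esym/kappa_prod/fsubsetP => y; rewrite !in_mdivisors => h.
  by rewrite (msubset_trans h) // msubsetDl.
rewrite fps_sum formal_sum /dlog_kappa /dlog_factor; case: ifPn => [odd_i|_]; last by rewrite big1.
rewrite formalZ (adams_sum _ _ xnu) ?odd_gt0 // mulr_sumr; apply: eq_bigr => mu _.
by rewrite formalZ mulrA.
Qed.

Lemma dlog_kappa0 P : dlog_kappa P 0 = 0. Proof. by []. Qed.

Lemma dlog_kappaD P P' : dlog_kappa (P + P') = dlog_kappa P + dlog_kappa P'.
Proof.
by apply/funext => n; rewrite fpsD /dlog_kappa; case: ifP; rewrite ?addr0 // adamsD scalerDr.
Qed.

Lemma kappa_uniq P h : has_dlog (dlog_kappa P) h -> h = kappa P.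
Proof.
move=> Nh; apply: has_dlog_uniq Nh (has_dlog_kappa P) => //.
exact: formal_torsion_free.
Qed.

Lemma kappaD P P' : kappa (P + P') = kappa P * kappa P'.
Proof.
by apply/esym/kappa_uniq; rewrite dlog_kappaD; apply: has_dlogM; exact: has_dlog_kappa.
Qed.

(** The substitution z -> z x^s; its result is a series in z over the series
    in x. *)
Definition twist (s : nat) (h : fps formal) : fps (fps formal) :=
  fps_scale (fps_mono _ s) (fps_map (@fps_cst formal) h).

Lemma twistE s h n : twist s h n = fps_cst (h n) * fps_mono _ (s * n).
Proof. by rewrite /twist /fps_scale /fps_map fps_monoX mulrC. Qed.

Lemma has_dlog_twist s a h : has_dlog a h -> has_dlog (twist s a) (twist s h).
Proof. by move=> Na; apply: has_dlog_scale; apply: has_dlog_map. Qed.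

(** Raising the variables to the power i sends x^s P_s to x^(i s) psi_i(P_s),
    which is the effect of z -> z x^s on the coefficient of z^i. *)
Lemma addvar_dlog_kappa M P : (forall s, (M <= s)%N -> addvar P s = 0) ->
  fps_map addvar (dlog_kappa P) = \sum_(s < M) twist s (dlog_kappa (addvar P s)).
Proof.
move=> addvarP0; apply/funext => n; apply/funext => j.
rewrite fps_sum fps_sum /fps_map /dlog_kappa.
under eq_bigr => s _ do rewrite twistE fps_cstM.
case: ifPn => [odd_n|_]; last by rewrite rmorph0 big1 // => s _; rewrite mul0r.
rewrite -[LHS]/(addvar (2 *: adams n P) j) addvarZ addvar_adams ?odd_gt0 //;
  case: dvdnP => [[d ->]|no].
  rewrite mulnK ?odd_gt0 //; have [lt_dM|ge_dM] := ltnP d M.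
    rewrite (bigD1 (Ordinal lt_dM)) //= /fps_mono eqxx mulr1 big1 ?addr0 // => s ne.
    rewrite eqn_pmul2r ?odd_gt0 //; case: eqP => [e|_]; last by rewrite mulr0.
    by case/eqP: ne; apply/val_inj.
  rewrite addvarP0 // adams0 scaler0 big1 // => s _; rewrite /fps_mono eqn_pmul2r ?odd_gt0 //.
  by rewrite gtn_eqF ?mulr0 // (leq_trans (ltn_ord s)).
rewrite scaler0 big1 // => s _; rewrite /fps_mono; case: eqP => [e|_]; last by rewrite mulr0.
by case: no; exists s.
Qed.

(** In the alphabet with x the sum P is the sum of the x^s P_s; both sides have
    the logarithmic derivative computed above. *)
Lemma addvar_kappa M P : (forall s, (M <= s)%N -> addvar P s = 0) ->
  fps_map addvar (kappa P) = \prod_(s < M) twist s (kappa (addvar P s)).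
Proof.
move=> addvarP0; apply: (@has_dlog_uniq _ (fps_map addvar (dlog_kappa P))).
- exact: fps_torsion_free formal_torsion_free.
- by rewrite /fps_map dlog_kappa0 rmorph0.
- exact/has_dlog_map/has_dlog_kappa.
- rewrite (addvar_dlog_kappa addvarP0).
  by apply: has_dlog_prod => s; apply: has_dlog_twist; exact: has_dlog_kappa.
Qed.

Arguments q _ : simpl never.
Arguments pleth z P : simpl never.
Arguments addvar f : simpl never.

(** * The q_n of the alphabet *)

Lemma kappa_alphabet n : kappa alphabet n = q n%:Z.
Proof. by []. Qed.

Lemma q_neg (z : int) : z < 0 -> q z = 0.
Proof. by case: z. Qed.

Lemma q0 : q 0 = 1.
Proof. by have [] := has_dlog_kappa alphabet. Qed.

Lemma mcons_msetn1 nu j i :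
  mcons nu j = msetn 1 i <->
  (i = 0%N /\ nu = mset0 /\ j = 1%N) \/ (exists i', [/\ i = i'.+1, nu = msetn 1 i' & j = 0%N]).
Proof.
split=> [h|[[-> [-> ->]]|[i' [-> -> ->]]]]; last 2 first.
- by apply/monomP => -[|l]; rewrite mconsE msetnE ?mset0E.
- by apply/monomP => -[|l]; rewrite mconsE !msetnE // eqSS.
have e l : mcons nu j l = msetn 1 i l by rewrite h.
case: i {h} e => [|i] e; [left|right; exists i]; split=> //.
- split; last by have := e 0%N; rewrite mconsE msetnE.
  by apply/monomP => l; have := e l.+1; rewrite mconsE msetnE mset0E.
- by apply/monomP => l; have := e l.+1; rewrite mconsE !msetnE eqSS.
- by have := e 0%N; rewrite mconsE msetnE.
Qed.

Lemma addvar_alphabet j : addvar alphabet j =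
  if j is 0%N then alphabet else if j is 1%N then 1 else 0.
Proof.
apply/funext => nu; rewrite /addvar /alphabet.
case: j => [|[|j]].
- congr (_%:R); congr nat_of_bool; apply/asboolP/asboolP => [[i /mcons_msetn1[[_ []]//|]]|[i ->]].
    by case=> i' [_ -> _]; exists i'.
  by exists i.+1; apply/mcons_msetn1; right; exists i.
- rewrite formal1; congr (_%:R); congr nat_of_bool.
  apply/asboolP/eqP => [[i /mcons_msetn1[[_ []]//|[? []]//]]|->].
  by exists 0%N; apply/mcons_msetn1; left.
- by case: asboolP => // -[i /mcons_msetn1[[_ []]//|[? []]//]].
Qed.

(** (1 + z) / (1 - z), the series of the q_n of a single variable at the value 1. *)
Definition kappa_one (n : nat) : formal := if n is 0%N then 1 else 2.

Lemma kappa1 : kappa 1 = kappa_one.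
Proof.
apply/esym/kappa_uniq.
have -> : dlog_kappa 1 = fps_cst (2 * 1) * fps_odd formal.
  apply/funext => n; rewrite fps_cstM /dlog_kappa /fps_odd; case: ifP => [odd_n|_];
    last by rewrite mulr0.
  by rewrite adams1 ?odd_gt0 // !mulr1 scaler_nat.
apply: has_dlog_odd => //.
rewrite mulr1 mulrBl mul1r fps_monoX; apply/funext => n; rewrite fpsD fpsN fps_cstM !fps_monoM.
case: n => [|[|n]]; rewrite /theta /kappa_one ?mulr0n ?subr0 ?mulr0 ?mulr1 ?mulr1n //=.
rewrite mul1n subn2 /=; case: n => [|n]; first by rewrite mulr0n subr0 mulr_natr.
by rewrite -[n.+3]/(2 + n.+1)%N mulrnDr addrK mulr_natr.
Qed.

(** The new variable multiplies the series of the q_n by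
    (1 + z x) / (1 - z x). *)
Lemma addvar_q (z : int) j : addvar (q z) j = kappa_one j * q (z - j%:Z).
Proof.
case: z => n; last first.
  by rewrite !q_neg ?mulr0 //; lia.
rewrite -kappa_alphabet -[LHS]/(fps_map addvar (kappa alphabet) n j) (@addvar_kappa 2); last first.
  by case=> [|[|s]] // _; rewrite addvar_alphabet.
rewrite !big_ord_recl big_ord0 mulr1 !addvar_alphabet /= kappa1 mulrC fpsM fps_sum.
under eq_bigr => i _ do rewrite !twistE mul0n fps_mono0 mulr1 mul1n mulrAC -rmorphM fps_cstM.
have [le_jn|lt_nj] := leqP j n.
  rewrite (bigD1 (Ordinal (le_jn : (j < n.+1)%N))) //= /fps_mono eqxx mulr1 big1 ?addr0.
    by rewrite kappa_alphabet; congr (_ * q _); lia.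
  by move=> i /eqP/val_eqP/= /negPf; rewrite eq_sym => ->; rewrite mulr0.
rewrite big1 => [|i _];
  last by rewrite /fps_mono gtn_eqF ?mulr0 // (leq_ltn_trans _ lt_nj) ?leq_ord.
by rewrite q_neg ?mulr0 //; lia.
Qed.

(** The logarithmic derivative of the series of the q_n is odd, so changing z
    to -z inverts the series. *)
Lemma q_alternating n :
  \sum_(l < n.+1) (-1) ^+ l * (q l%:Z * q (n%:Z - l%:Z)) = (n == 0%N)%:R :> formal.
Proof.
have E : fps_scale (-1) (kappa alphabet) * kappa alphabet = 1.
  apply: (@has_dlog_uniq _ 0) => //; last exact: has_dlog1.
    exact: formal_torsion_free.
  have N := has_dlog_kappa alphabet.
  have := has_dlogM (has_dlog_scale (-1) N) N; congr has_dlog.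
  apply/funext => i; rewrite fpsD /fps_scale /dlog_kappa; case: ifP => [odd_i|_];
    last by rewrite mulr0 addr0.
  by rewrite -signr_odd odd_i mulN1r addNr.
rewrite -[RHS](congr1 (fun f : fps formal => f n) E) fpsM; apply: eq_bigr => l _.
by rewrite /fps_scale !kappa_alphabet -mulrA -subzn // -ltnS.
Qed.

(** * Gamma contains the plethysms of the q_m *)

Lemma GammaP f : Gamma f <->
  forall S : set formal, GRing.subalg_closed (mem S) -> (forall z, S (q z)) -> S f.
Proof.
split=> [h S clS Sq|h S [clS Sq]]; first by apply: h; split=> // _ [z _ <-].
by apply: h => // z; apply: Sq; exists z.
Qed.

Lemma subalg_closedI (S : set formal) : S 1 ->
  (forall c u v, S u -> S v -> S (c *: u + v)) -> (forall u v, S u -> S v -> S (u * v)) ->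
  GRing.subalg_closed (mem S).
Proof.
move=> S1 SZ SM; split=> [|c u v|u v]; rewrite !in_setE //.
- exact: SZ.
- exact: SM.
Qed.

Lemma Gamma_ind (S : set formal) : S 1 ->
  (forall c u v, S u -> S v -> S (c *: u + v)) -> (forall u v, S u -> S v -> S (u * v)) ->
  (forall z, S (q z)) -> forall f, Gamma f -> S f.
Proof. by move=> S1 SZ SM Sq f /GammaP; apply=> //; exact: subalg_closedI. Qed.

Lemma Gamma1 : Gamma 1.
Proof. by apply/GammaP => S [+ _ _] _; rewrite in_setE. Qed.

Lemma GammaZD c u v : Gamma u -> Gamma v -> Gamma (c *: u + v).
Proof.
move=> /GammaP Gu /GammaP Gv; apply/GammaP => S clS Sq.
have [_ SZ _] := clS; have := SZ c u v; rewrite !in_setE; apply; [exact: Gu|exact: Gv].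
Qed.

Lemma GammaM u v : Gamma u -> Gamma v -> Gamma (u * v).
Proof.
move=> /GammaP Gu /GammaP Gv; apply/GammaP => S clS Sq.
have [_ _ SM] := clS; have := SM u v; rewrite !in_setE; apply; [exact: Gu|exact: Gv].
Qed.

Lemma Gamma_q z : Gamma (q z).
Proof. by apply/GammaP => S _; apply. Qed.

Lemma Gamma0 : Gamma 0.
Proof. by rewrite -(addNr 1) -scaleN1r; apply: GammaZD; exact: Gamma1. Qed.

Lemma GammaZ c u : Gamma u -> Gamma (c *: u).
Proof. by move=> Gu; rewrite -[_ *: _]addr0; apply: GammaZD => //; exact: Gamma0. Qed.

Lemma GammaD u v : Gamma u -> Gamma v -> Gamma (u + v).
Proof. by move=> Gu Gv; rewrite -[u]scale1r; exact: GammaZD. Qed.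

Lemma Gamma_sum (I : Type) (r : seq I) (Q : pred I) (F : I -> formal) :
  (forall i, Q i -> Gamma (F i)) -> Gamma (\sum_(i <- r | Q i) F i).
Proof.
by move=> GF; apply: big_ind => //; [exact: Gamma0|exact: GammaD].
Qed.

Lemma Gamma_divn u n : Gamma (u *+ n.+1) -> Gamma u.
Proof.
move=> Gu; have -> : u = (n.+1%:R : rat)^-1 *: (u *+ n.+1).
  by rewrite -scaler_nat scalerA mulVf ?scale1r // pnatr_eq0.
exact: GammaZ.
Qed.

Lemma kappa_rec P n :
  kappa P n *+ n = \sum_(i < n.+1) dlog_kappa P i * kappa P (n - i)%N.
Proof. by have [_ /(congr1 (fun f : fps formal => f n))] := has_dlog_kappa P. Qed.

(** For i odd, psi_i(A) is the power sum p_i, and the recursion of the q_n can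
    be solved for it. *)
Lemma Gamma_adams_alphabet n : odd n -> Gamma (adams n alphabet).
Proof.
elim/ltn_ind: n => n IHn odd_n; have n0 := odd_gt0 odd_n.
have : Gamma (2 *: adams n alphabet).
  have := kappa_rec alphabet n; rewrite big_ord_recr /= subnn {2}/dlog_kappa odd_n => E.
  have K0 : kappa alphabet 0%N = 1 by exact: q0.
  rewrite K0 mulr1 in E;
    rewrite -[_ *: _](addKr (\sum_(i < n) dlog_kappa alphabet i * kappa alphabet (n - i)%N)) -E.
  apply: GammaD; last first.
    by rewrite -(@scaler_nat rat) kappa_alphabet; apply: GammaZ; exact: Gamma_q.
  rewrite -scaleN1r; apply: GammaZ; apply: Gamma_sum => i _; apply: GammaM;
    last by rewrite kappa_alphabet; exact: Gamma_q.
  rewrite /dlog_kappa; case: ifP => [odd_i|_]; last exact: Gamma0.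
  by apply: GammaZ; apply: IHn.
by rewrite scaler_nat; exact: (@Gamma_divn _ 1).
Qed.

(** Apply psi_i to the recursion of the q_m: it sends the power sum p_j to
    p_(i j), and i j is odd when i and j are. *)
Lemma Gamma_adams_q i m : odd i -> Gamma (adams i (q m%:Z)).
Proof.
move=> odd_i; have i0 := odd_gt0 odd_i; elim/ltn_ind: m => -[|m] IHm.
  by rewrite q0 adams1 //; exact: Gamma1.
apply: (@Gamma_divn _ m); have adamsMn u k : adams i (u *+ k) = adams i u *+ k.
  by rewrite -!(@scaler_nat rat) adamsZ.
rewrite -adamsMn -kappa_alphabet kappa_rec (big_morph (adams i) (adamsD i) (adams0 i)).
apply: Gamma_sum => j _; rewrite adamsM //; case: j => -[|j] lt_j /=.
  by rewrite /dlog_kappa /= adams0 mul0r; exact: Gamma0.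
apply: GammaM; last by rewrite kappa_alphabet; apply: IHm; rewrite subSS ltnS leq_subr.
rewrite /dlog_kappa; case: ifP => [odd_j|_]; last by rewrite adams0; exact: Gamma0.
by rewrite adamsZ adams_adams //; apply: GammaZ; apply: Gamma_adams_alphabet; rewrite oddM odd_i.
Qed.

Lemma Gamma_pleth n m : Gamma (kappa (q m%:Z) n).
Proof.
elim/ltn_ind: n => -[|n] IHn; first by have [-> _] := has_dlog_kappa (q m%:Z); exact: Gamma1.
apply: (@Gamma_divn _ n); rewrite kappa_rec; apply: Gamma_sum => -[[|j] lt_j] _ /=.
  by rewrite mul0r; exact: Gamma0.
apply: GammaM; last by apply: IHn; rewrite subSS ltnS leq_subr.
rewrite /dlog_kappa; case: ifP => [odd_j|_]; last exact: Gamma0.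
by apply: GammaZ; apply: Gamma_adams_q.
Qed.

(** * Signed sums over the deletions of one entry of a list *)

Section Dsum.
Variable R : comNzRingType.
Implicit Types (a b : nat -> R) (F G : seq nat -> R) (l m : seq nat).

(** The sum over the entries x of [l], in position i counted from 0, of
    (-1)^i a(x) F(l without that entry).  It is the Laplace expansion of a
    Pfaffian along a row with entries a(x).  The recursive form makes the
    identities below inductions on [l], without manipulation of signs. *)
Fixpoint dsum a F l : R :=
  if l is x :: l' then a x * F l' - dsum a (fun m => F (x :: m)) l' else 0.

Lemma perm_swap2 (x y : nat) m l : perm_eq (y :: m) l -> perm_eq [:: y, x & m] (x :: l).
Proof.
move=> yml; apply: perm_trans (_ : perm_eq [:: x, y & m] _); last by rewrite perm_cons.
by have /permPl := perm_catCA [:: y] [:: x] m.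
Qed.

Lemma eq_dsum a b F G l :
    (forall x m, perm_eq (x :: m) l -> a x * F m = b x * G m) ->
  dsum a F l = dsum b G l.
Proof.
elim: l F G => //= x l IHl F G h; rewrite h ?perm_refl //; congr (_ - _).
by apply: IHl => y m yml; apply: h; exact: perm_swap2.
Qed.

Lemma dsum_closed (V : R -> Prop) a F l : V 0 -> (forall u v, V u -> V v -> V (u - v)) ->
  (forall x m, perm_eq (x :: m) l -> V (a x * F m)) -> V (dsum a F l).
Proof.
move=> V0 VB; elim: l F => //= x l IHl F h; apply: VB; first by apply: h.
by apply: IHl => y m yml; apply: h; exact: perm_swap2.
Qed.

Lemma dsum0 a F l : (forall x m, perm_eq (x :: m) l -> a x * F m = 0) -> dsum a F l = 0.
Proof. by move=> h; apply: (@dsum_closed (eq^~ 0)) => // u v -> ->; rewrite subr0. Qed.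

Lemma dsumDr a F G l : dsum a (fun m => F m + G m) l = dsum a F l + dsum a G l.
Proof. by elim: l F G => [|x l IHl] F G /=; rewrite ?addr0 // IHl; ring. Qed.

Lemma dsumZr a c F l : dsum a (fun m => c * F m) l = c * dsum a F l.
Proof. by elim: l F => [|x l IHl] F /=; rewrite ?mulr0 // IHl; ring. Qed.

Lemma dsumDl a b F l : dsum (fun x => a x + b x) F l = dsum a F l + dsum b F l.
Proof. by elim: l F => [|x l IHl] F /=; rewrite ?addr0 // IHl; ring. Qed.

Lemma dsumZl a c F l : dsum (fun x => c * a x) F l = c * dsum a F l.
Proof. by elim: l F => [|x l IHl] F /=; rewrite ?mulr0 // IHl; ring. Qed.

Lemma dsum_suml (I : Type) (r : seq I) (a : I -> nat -> R) F l :
  dsum (fun x => \sum_(i <- r) a i x) F l = \sum_(i <- r) dsum (a i) F l.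
Proof.
elim: r => [|i r IHr].
  by rewrite big_nil; apply: dsum0 => x m _; rewrite big_nil mul0r.
rewrite big_cons -IHr -dsumDl; apply: eq_dsum => x m _; by rewrite big_cons.
Qed.

Lemma dsum_anticomm a b F l :
  dsum a (fun m => dsum b F m) l = - dsum b (fun m => dsum a F m) l.
Proof.
elim: l F => [|x l IHl] F /=; first by rewrite oppr0.
have swap a' b' : dsum a' (fun m => dsum b' F (x :: m)) l =
    b' x * dsum a' F l - dsum a' (fun m => dsum b' (fun m' => F (x :: m')) m) l.
  by rewrite -dsumZr -mulN1r -dsumZr -dsumDr; apply: eq_dsum => y m _ /=; ring.
by rewrite !swap IHl; ring.
Qed.

Lemma dsum_sqr a F l : dsum a (fun m => dsum a F m) l = 0.
Proof.
elim: l F => [|x l IHl] F //=.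
have -> : dsum a (fun m => dsum a F (x :: m)) l =
    a x * dsum a F l - dsum a (fun m => dsum a (fun m' => F (x :: m')) m) l.
  by rewrite -dsumZr -mulN1r -dsumZr -dsumDr; apply: eq_dsum => y m _ /=; ring.
by rewrite IHl; ring.
Qed.

End Dsum.

Lemma dsum_morph (R S : comNzRingType) (h : {rmorphism R -> S}) a F l :
  h (dsum a F l) = dsum (fun x => h (a x)) (fun m => h (F m)) l.
Proof. by elim: l F => [|x l IHl] F /=; rewrite ?rmorph0 // rmorphB rmorphM IHl. Qed.

Lemma dsum_coef (R : comNzRingType) (a : nat -> fps R) (F : seq nat -> R) l j :
  dsum a (fun m => fps_cst (F m)) l j = dsum (fun x => a x j) F l.
Proof.
by elim: l F => [|x l IHl] F //=; rewrite fpsD fpsN mulrC fps_cstM mulrC IHl.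
Qed.

(** * Vertex operators and the functions that they generate *)

(** Up to the sign (-1)^z, the coefficient of t^z in the product of
    sum_n q_n t^n with h at x = -1/t. *)
Definition vertex_eval (z : int) (h : fps formal) : formal :=
  \sum_(j \in [set: nat]) (-1 : rat) ^ (z + j%:Z) *: (q (z + j%:Z) * h j).

Lemma vertex_evalE N z h : (forall j, (N <= j)%N -> h j = 0) ->
  vertex_eval z h = \sum_(j < N) (-1 : rat) ^ (z + j%:Z) *: (q (z + j%:Z) * h j).
Proof.
move=> h0; rewrite /vertex_eval (fsbigE (index_iota 0 N)) ?iota_uniq //; last first.
  by move=> j _; rewrite mem_index_iota -leqNgt => /h0 ->; rewrite mulr0 scaler0.
by under eq_bigl do rewrite in_setT; rewrite big_mkord.
Qed.

Definition vertex (z : int) (f : formal) : formal := vertex_eval z (addvar f).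

Definition Qv (l : seq nat) : formal :=
  foldr (fun r f => (-1 : rat) ^+ r *: vertex r%:Z f) 1 l.

Definition q_cst (r : nat) : fps formal := fps_cst (q r%:Z).
Definition dq (r : nat) : fps formal := addvar (q r%:Z) - q_cst r.

Lemma dqE r j : dq r j = if j is 0%N then 0 else 2 * q (r%:Z - j%:Z).
Proof.
rewrite /dq fpsD fpsN addvar_q /q_cst; case: j => [|j]; last by rewrite subr0.
by rewrite subr0 mul1r subrr.
Qed.

Lemma dq0 : dq 0 = 0.
Proof.
by apply/funext; case=> [|j]; rewrite dqE // q_neg ?mulr0.
Qed.

Lemma dqS r : dq r.+1 = fps_mono _ 1 * (2 * q_cst r + dq r).
Proof.
apply/funext => j; rewrite fps_monoM dqE; case: j => [|j] //=.
rewrite subn1 /= fpsD -(rmorph_nat (@fps_cst formal)) /q_cst -rmorphM dqE.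
case: j => [|j] /=; first by rewrite addr0; congr (2 * q _); lia.
by rewrite add0r; congr (2 * q _); lia.
Qed.

Definition Qpair_corr (r s : nat) : formal :=
  2 * \sum_(l < s) (-1) ^+ l.+1 * (q (r + l.+1)%:Z * q (s%:Z - l.+1%:Z)).

Lemma QpairE (r s : nat) : Qpair r%:Z s%:Z = q r%:Z * q s%:Z + Qpair_corr r s.
Proof.
rewrite /Qpair /Qpair_corr; congr (_ + 2 * _); rewrite big_add1 /= big_mkord.
by apply: eq_bigr => i _; congr (_ * (q _ * _)); lia.
Qed.

Lemma Qpair_corr0 r : Qpair_corr r 0 = 0.
Proof. by rewrite /Qpair_corr big_ord0 mulr0. Qed.

Lemma Qpair_corrS r s : Qpair_corr r s.+1 = - (2 * (q r.+1%:Z * q s%:Z)) - Qpair_corr r.+1 s.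
Proof.
rewrite /Qpair_corr big_ord_recl /= expr1 mulN1r mulrDr mulrN.
have -> : (s.+1%:Z - 1 = s%:Z :> int) by lia.
rewrite addn1; congr (_ + _); rewrite -mulrN -sumrN; congr (_ * _); apply: eq_bigr => i _.
rewrite /bump /= add1n exprS mulN1r mulNr addSnnS.
by have -> : s.+1%:Z - i.+2%:Z = s%:Z - i.+1%:Z by lia.
Qed.

(** The recursion in s reduces the claim to the equality of
    d_(r+1) (2 q_s + d_s) and (2 q_r + d_r) d_(s+1), where d_r = [dq r]; both are
    x (2 q_r + d_r) (2 q_s + d_s) by [dqS]. *)
Lemma addvar_Qpair_corr r s : addvar (Qpair_corr r s) =
  fps_cst (Qpair_corr r s) - 2 * q_cst r * dq s - dq r * dq s.
Proof.
elim: s r => [|s IHs] r.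
  by rewrite Qpair_corr0 dq0 !rmorph0 !mulr0 !subr0.
have Tq n : addvar (q n%:Z) = q_cst n + dq n by rewrite addrC subrK.
rewrite Qpair_corrS; move: (Qpair_corr r.+1 s) (IHs r.+1) => X TX.
by rewrite !(rmorphB, rmorphN, rmorphM, rmorph_nat) /= !Tq TX -!/(q_cst _) !dqS; ring.
Qed.

Lemma sgnZ (i : nat) (f : formal) : (-1 : rat) ^+ i *: f = (-1) ^+ i * f.
Proof. by rewrite -(signr_odd rat) -(signr_odd formal) scaler_sign mulr_sign. Qed.

Lemma sgnZZ (r j : nat) (f : formal) :
  (-1 : rat) ^+ r *: ((-1 : rat) ^ (r%:Z + j%:Z) *: f) = (-1) ^+ j * f.
Proof.
by rewrite -PoszD -exprnP exprD !scalerA mulrA -expr2 sqrr_sign mul1r sgnZ.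
Qed.

Lemma leq_sumn (x : nat) (m l : seq nat) : perm_eq (x :: m) l -> (x <= sumn l)%N.
Proof. by move=> /perm_sumn <- /=; rewrite leq_addr. Qed.

Arguments Qv l : simpl never.

(** A variable x acts on Qv(l) by deleting at most one part.  The statement is
    named because it and the recursion of Qv are proved together by induction
    on the length of the list. *)
Definition addvar_Qv_spec (l : seq nat) :=
  addvar (Qv l) = fps_cst (Qv l) + dsum dq (fun m => fps_cst (Qv m)) l.

Section Coef.
Variables (l : seq nat) (Al : addvar_Qv_spec l).

Lemma addvar_Qv_coef0 : addvar (Qv l) 0%N = Qv l.
Proof. by rewrite Al fpsD dsum_coef dsum0 ?addr0 // => x m _; rewrite dqE mul0r. Qed.

Lemma addvar_Qv_coefS j : addvar (Qv l) j.+1 = 2 * dsum (fun s => q (s%:Z - j.+1%:Z)) Qv l.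
Proof.
rewrite Al fpsD dsum_coef -dsumZl [X in X + _]/= add0r.
by apply: eq_dsum => x m _; rewrite dqE.
Qed.

Lemma addvar_Qv_support j : (sumn l < j)%N -> addvar (Qv l) j = 0.
Proof.
case: j => // j lt_j; rewrite addvar_Qv_coefS dsum0 ?mulr0 // => x m /leq_sumn le_x.
by rewrite q_neg ?mul0r //; lia.
Qed.

(** Substitute the coefficients of [addvar (Qv l)] into the definition of V_r:
    the coefficient of x^0 contributes q_r Qv(l), and the deletions of s
    contribute 2 sum_(j >= 1) (-1)^j q_(r + j) q_(s - j) = [Qpair_corr r s]. *)
Lemma Qv_cons_spec r : Qv (r :: l) = q r%:Z * Qv l + dsum (Qpair_corr r) Qv l.
Proof.
rewrite -[LHS]/((-1 : rat) ^+ r *: vertex r%:Z (Qv l)) /vertex (@vertex_evalE (sumn l).+1);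
  last exact: addvar_Qv_support.
rewrite scaler_sumr; under eq_bigr => j _ do rewrite sgnZZ.
rewrite big_ord_recl expr0 mul1r addvar_Qv_coef0 addr0; congr (_ + _).
pose a j s := (-1) ^+ j.+1 * (q (r%:Z + j.+1%:Z) * (2 * q (s%:Z - j.+1%:Z))).
transitivity (\sum_(j < sumn l) dsum (a j) Qv l).
  apply: eq_bigr => j _; rewrite lift0 addvar_Qv_coefS /a dsumZl.
  by rewrite dsumZl dsumZl.
rewrite -dsum_suml; apply: eq_dsum => s m /leq_sumn le_s.
suff -> : \sum_(j < sumn l) a j s = Qpair_corr r s by [].
rewrite /Qpair_corr mulr_sumr (big_ord_widen _ (fun j =>
  2 * ((-1) ^+ j.+1 * (q (r + j.+1)%:Z * q (s%:Z - j.+1%:Z)))) le_s) [RHS]big_mkcond /=.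
apply: eq_bigr => j _; rewrite /a PoszD; case: ltnP => [_|le_sj]; first by ring.
by rewrite [X in 2 * X]q_neg ?mulr0 //; lia.
Qed.

End Coef.

(** Expand both sides by [Qv_cons_spec].  The terms in which two parts are
    deleted with the same coefficient cancel, and the deletions with the
    coefficients d and [Qpair_corr] anticommute. *)
Lemma addvar_Qv l : addvar_Qv_spec l.
Proof.
have [n] := ubnP (size l); elim: n l => // n IHn [|r l].
  by move=> _; rewrite /addvar_Qv_spec /= addr0 -[Qv [::]]/1 !rmorph1.
rewrite /= ltnS => le_n.
have Al : addvar_Qv_spec l by apply: IHn.
have szm x m : perm_eq (x :: m) l -> (size m < n)%N.
  by move=> /perm_size szl; rewrite -szl in le_n; exact: ltnW.
have Am x m : perm_eq (x :: m) l -> addvar_Qv_spec m by move=> /szm /IHn.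
pose PS m := fps_cst (Qv m); pose RS r s := fps_cst (Qpair_corr r s).
have Tq : addvar (q r%:Z) = q_cst r + dq r by rewrite addrC subrK.
have expS m : addvar_Qv_spec m -> PS (r :: m) = q_cst r * PS m + dsum (RS r) PS m.
  by move=> Bm; rewrite /PS (Qv_cons_spec Bm) rmorphD rmorphM /= dsum_morph.
rewrite /addvar_Qv_spec -/(PS (r :: l)) (Qv_cons_spec Al) rmorphD rmorphM dsum_morph /= Al Tq.
rewrite expS // -!/(PS _).
pose D := dsum dq PS l.
have -> : dsum (fun x => addvar (Qpair_corr r x)) (fun m => addvar (Qv m)) l =
    dsum (RS r) PS l + dsum (RS r) (fun m => dsum dq PS m) l - (2 * q_cst r + dq r) * D.
  rewrite (@eq_dsum _ _ (fun x => RS r x + - (2 * q_cst r + dq r) * dq x) _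
            (fun m => PS m + dsum dq PS m)); last first.
    by move=> x m /Am Bm /=; rewrite Bm addvar_Qpair_corr -/(RS r x) -!/(PS _); ring.
  rewrite dsumDl dsumZl !dsumDr dsum_sqr addr0 -/D; ring.
have -> : dsum dq (fun m => PS (r :: m)) l = q_cst r * D + dsum dq (fun m => dsum (RS r) PS m) l.
  rewrite -dsumZr -dsumDr; apply: eq_dsum => x m /Am Bm; by rewrite expS.
by rewrite (dsum_anticomm dq (RS r)) -/D; ring.
Qed.

Lemma Qv_cons r l : Qv (r :: l) = q r%:Z * Qv l + dsum (Qpair_corr r) Qv l.
Proof. exact/Qv_cons_spec/addvar_Qv. Qed.

(** Expansion along the row of a part 0, as [Qpair s 0] is q_s: for an odd
    number of parts this is the Pfaffian with the part 0 added.  For an even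
    number it is a Pfaffian with two equal rows, hence 0. *)
Lemma dsum_q_Qv l : dsum (fun s => q s%:Z) Qv l = if odd (size l) then Qv l else 0.
Proof.
have [n] := ubnP (size l); elim: n l => // n IHn [|r l] //.
rewrite [size _]/= ltnS => le_n; rewrite [LHS]/=.
have -> : dsum (fun s => q s%:Z) (fun m => Qv (r :: m)) l =
    q r%:Z * dsum (fun s => q s%:Z) Qv l -
    dsum (Qpair_corr r) (fun m => dsum (fun s => q s%:Z) Qv m) l.
  rewrite -dsum_anticomm -dsumZr -dsumDr; apply: eq_dsum => x m _.
  by rewrite Qv_cons.
rewrite IHn // (@eq_dsum _ _ (Qpair_corr r) _ (fun m => if odd (size l) then 0 else Qv m));
  last first.
  move=> x m xml; have /= szl := perm_size xml.
  rewrite -szl in le_n *; rewrite IHn; last exact: ltnW.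
  by rewrite /=; case: (odd _).
rewrite oddS Qv_cons; case: (odd (size l)) => /=.
  by rewrite (@dsum0 _ (Qpair_corr r)) ?subr0 ?subrr // => x m _; rewrite mulr0.
by rewrite mulr0 sub0r opprK.
Qed.

(** * V_(-k) deletes the part k *)

(** The series of the q_n at z and at -z are inverse to each other; the sum
    over j runs in effect from k to s. *)
Lemma q_delta k s N : (s < N)%N ->
  \sum_(j < N) (-1 : rat) ^ (- k%:Z + j%:Z) *: (q (- k%:Z + j%:Z) * q (s%:Z - j%:Z))
    = (s == k)%:R :> formal.
Proof.
move=> lt_sN; rewrite -(big_mkord xpredT (fun j : nat =>
  (-1 : rat) ^ (- k%:Z + j%:Z) *: (q (- k%:Z + j%:Z) * q (s%:Z - j%:Z)))).
have [le_ks|lt_sk] := leqP k s; last first.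
  rewrite big1 ?ltn_eqF // => j _; have [lt_jk|le_kj] := ltnP j k.
    by rewrite q_neg ?mul0r ?scaler0 //; lia.
  by rewrite [X in _ * X]q_neg ?mulr0 ?scaler0 //; lia.
rewrite (big_cat_nat (n := k)) //=; last exact: leq_trans le_ks (ltnW lt_sN).
rewrite big_nat big1 ?add0r => [|j /andP[_ lt_jk]]; last first.
  by rewrite q_neg ?mul0r ?scaler0 //; lia.
rewrite (big_cat_nat (n := s.+1)) //=; last exact: leqW.
rewrite [X in _ + X]big_nat [X in _ + X]big1 ?addr0 => [|j /andP[lt_sj _]]; last first.
  by rewrite [X in _ * X]q_neg ?mulr0 ?scaler0 //; lia.
rewrite -{1}[k]add0n big_addn big_mkord subSn //.
rewrite -[RHS](_ : (s - k == 0)%N%:R = _); last by rewrite subn_eq0 eqn_leq le_ks andbT.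
rewrite -q_alternating; apply: eq_bigr => i _.
have -> : - k%:Z + (i + k)%N%:Z = i%:Z by lia.
have -> : s%:Z - (i + k)%N%:Z = (s - k)%N%:Z - i%:Z by lia.
by rewrite -exprnP sgnZ.
Qed.

Lemma vertex_Qv k l : (0 < k)%N ->
  vertex (- k%:Z) (Qv l) = 2 * dsum (fun s => (s == k)%:R) Qv l.
Proof.
move=> k0; rewrite /vertex (@vertex_evalE (sumn l).+1); last by apply: addvar_Qv_support;
  exact: addvar_Qv.
rewrite big_ord_recl q_neg ?mul0r ?scaler0 ?add0r; last by rewrite /=; lia.
pose a j s := 2 * ((-1 : rat) ^ (- k%:Z + j.+1%:Z) *:
  (q (- k%:Z + j.+1%:Z) * q (s%:Z - j.+1%:Z))).
transitivity (\sum_(j < sumn l) dsum (a j) Qv l).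
  apply: eq_bigr => j _; rewrite lift0 (addvar_Qv_coefS (addvar_Qv l)) -dsumZl -dsumZl.
  rewrite -mulr_algl -dsumZl; apply: eq_dsum => s m _.
  by rewrite mulr_algl /a mulrCA scalerAr.
rewrite -dsum_suml -dsumZl; apply: eq_dsum => s m /leq_sumn le_s.
suff -> : \sum_(j < sumn l) a j s = 2 * (s == k)%:R by [].
rewrite -(@q_delta k s (sumn l).+1) // big_ord_recl q_neg; last by rewrite /=; lia.
by rewrite mul0r scaler0 add0r mulr_sumr.
Qed.

Lemma dsum_pick (R : comNzRingType) k (F : seq nat -> R) l : (count_mem k l <= 1)%N ->
  dsum (fun s => (s == k)%:R) F l =
  if k \in l then (-1) ^+ index k l * F (rem k l) else 0.
Proof.
elim: l F => //= x l IHl F; rewrite in_cons; case: (eqVneq x k) => [->|ne] /=.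
  rewrite add1n ltnS leqn0 => /eqP/count_memPn nin; rewrite expr0 dsum0 ?subr0 //.
  move=> y m /perm_mem /(_ y); rewrite mem_head => yl.
  by case: eqP => [yk|_]; [move: nin; rewrite -yk -yl|rewrite mul0r].
rewrite add0n => /IHl ->; rewrite mul0r sub0r.
by case: ifP => _; rewrite ?oppr0 // exprS mulN1r mulNr.
Qed.

Lemma strict_count k l : (0 < k)%N -> strict_partition l -> (count_mem k l <= 1)%N.
Proof.
move=> k0 /andP[_ ul]; have h := count_uniq_mem k ul.
have := leq_b1 (k \in [seq x <- l | x != 0%N]); rewrite -h count_filter.
by rewrite (@eq_count _ _ (pred1 k)) // => x /=; case: eqP => // ->; rewrite -lt0n.
Qed.

Lemma vertex_Qv_strict k l : (0 < k)%N -> strict_partition l ->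
  vertex (- k%:Z) (Qv l) = if k \in l then (-1) ^+ (index k l).+2 * 2 * Qv (rem k l) else 0.
Proof.
move=> k0 /(strict_count k0) h; rewrite vertex_Qv // dsum_pick //.
by case: ifP => _; rewrite ?mulr0 // !exprS !mulN1r opprK mulrA [2 * _]mulrC.
Qed.

(** * Straightening to strict partitions *)

(** [Qpair] is antisymmetric except at (0, 0).  The sum
    [Qpair a (b + 1) + Qpair (a + 1) b] is antisymmetric in a and b, which
    moves the claim along the antidiagonal to s = 0, where it is
    [q_alternating]. *)
Lemma Qpair_anticomm (r s : nat) :
  Qpair r%:Z s%:Z + Qpair s%:Z r%:Z = 2 * ((r == 0%N) && (s == 0%N))%:R.
Proof.
elim: s r => [|s IHs] r.
  have E : q r%:Z + \sum_(l < r) (-1) ^+ l.+1 * (q (0 + l.+1)%:Z * q (r%:Z - l.+1%:Z)) =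
    (r == 0%N)%:R.
    by rewrite -q_alternating big_ord_recl expr0 q0 !mul1r subr0.
  rewrite !QpairE q0 Qpair_corr0 mulr1 mul1r andbT -E /Qpair_corr.
  by move: (\sum_(l < r) _) => S; ring.
rewrite andbF mulr0; have := IHs r.+1; rewrite /= mulr0 => E.
have rec (a b : nat) : Qpair a%:Z b.+1%:Z + Qpair a.+1%:Z b%:Z =
    q a%:Z * q b.+1%:Z - q a.+1%:Z * q b%:Z.
  by rewrite !QpairE Qpair_corrS; ring.
have := congr2 +%R (rec r s) (rec s r); rewrite [X in _ + X = _]addrC addrACA E addr0 => ->.
by ring.
Qed.

Lemma formal_double (x : formal) : x + x = 0 -> x = 0.
Proof. by rewrite -mulr2n; exact: formal_torsion_free. Qed.

(** By [Qv_cons] twice: the deletions of two further parts anticommute, so only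
    the pairing of r with s survives in the sum. *)
Lemma Qv_swap r s l :
  Qv [:: r, s & l] + Qv [:: s, r & l] = 2 * ((r == 0%N) && (s == 0%N))%:R * Qv l.
Proof.
have E a b : Qv [:: a, b & l] = q a%:Z * (q b%:Z * Qv l + dsum (Qpair_corr b) Qv l) +
    (Qpair_corr a b * Qv l - (q b%:Z * dsum (Qpair_corr a) Qv l +
      dsum (Qpair_corr a) (fun m => dsum (Qpair_corr b) Qv m) l)).
  rewrite Qv_cons Qv_cons [dsum _ _ (b :: l)]/= -dsumZr -dsumDr.
  have -> // : dsum (Qpair_corr a) (fun m => Qv (b :: m)) l =
    dsum (Qpair_corr a) (fun m => q b%:Z * Qv m + dsum (Qpair_corr b) Qv m) l.
  by apply: eq_dsum => x m _; rewrite Qv_cons.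
rewrite -Qpair_anticomm !E (dsum_anticomm (Qpair_corr s) (Qpair_corr r)) !QpairE; ring.
Qed.

Lemma Qv_zeros l : Qv [:: 0, 0 & l]%N = Qv l.
Proof.
have /eqP := Qv_swap 0 0 l; rewrite mulr1 mulr_natl mulr2n -subr_eq0 opprD addrACA.
by move=> /eqP/formal_double/eqP; rewrite subr_eq0 => /eqP.
Qed.

Lemma Qv_repeat r l : (0 < r)%N -> Qv [:: r, r & l] = 0.
Proof.
move=> r0; apply: formal_double; rewrite Qv_swap.
by rewrite gtn_eqF //= mulr0 mul0r.
Qed.

Lemma Qv_anti r s l : (0 < s)%N -> Qv [:: r, s & l] = - Qv [:: s, r & l].
Proof.
move=> s0; apply/eqP; rewrite -subr_eq0 opprK Qv_swap.
by rewrite [s == _]gtn_eqF //= andbF mulr0 mul0r.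
Qed.

Lemma vertex_eval_scale N z c h : (forall j, (N <= j)%N -> h j = 0) ->
  vertex_eval z (fun j => c *: h j) = c *: vertex_eval z h.
Proof.
move=> h0; rewrite !(@vertex_evalE N) // => [|j /h0 ->]; last by rewrite scaler0.
by rewrite scaler_sumr; apply: eq_bigr => j _; rewrite -scalerAr !scalerA mulrC.
Qed.

Lemma Qv_consZ s c l m : Qv l = c *: Qv m -> Qv (s :: l) = c *: Qv (s :: m).
Proof.
move=> E; rewrite -[LHS]/(_ *: vertex s%:Z (Qv l)) E.
rewrite /vertex -[addvar _]/((fun j => c *: addvar (Qv m) j) :
  fps formal) (@vertex_eval_scale (sumn m).+1).
  by rewrite scalerA mulrC -scalerA.
by apply: addvar_Qv_support; exact: addvar_Qv.
Qed.

Lemma strict_cons s l : strict_partition (s :: l) ->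
  [/\ strict_partition l, all (geq s) l & (0 < s)%N -> all (gtn s) l].
Proof.
rewrite /strict_partition /=; rewrite path_sortedE; last first.
  by move=> a b c; rewrite /geq /= => h1 h2; exact: leq_trans h2 h1.
move=> /andP[/andP[le_l sorted_l] ul]; split=> //.
  by rewrite sorted_l; move: ul; case: ifP => // _ /andP[].
move=> s0; move: ul; rewrite -lt0n s0 /= => /andP[sl _].
apply/allP => x xl; have /allP/(_ x xl)/= := le_l; rewrite leq_eqVlt => /predU1P[xs|//].
by move: sl; rewrite mem_filter -xs xl andbT -lt0n xs s0.
Qed.

Lemma cons_strict s l : (0 < s)%N -> strict_partition l -> all (gtn s) l ->
  strict_partition (s :: l).
Proof.
move=> s0 /andP[sl ul] ltl; rewrite /strict_partition /= path_sortedE; last first.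
  by move=> a b c; rewrite /geq /= => h1 h2; exact: leq_trans h2 h1.
rewrite sl andbT -lt0n s0 /= ul andbT; apply/andP; split.
  by apply: sub_all ltl => x /=; exact: ltnW.
by apply/negP; rewrite mem_filter => /andP[_ /(allP ltl)/=]; rewrite ltnn.
Qed.

(** The new part moves right past larger parts, with a sign, until it is in
    place or meets an equal part.  The bound on the parts of m is the induction
    hypothesis that allows a larger part to be put back in front. *)
Lemma Qv_insert r l : strict_partition l ->
  exists c m, [/\ strict_partition m, Qv (r :: l) = c *: Qv m &
    forall b, (r < b)%N -> all (gtn b) l -> all (gtn b) m].
Proof.
elim: l => [_|s l IHl sl].
  exists 1, [:: r]; rewrite scale1r; split=> // [|b /= -> //].
  by rewrite /strict_partition /=; case: (r != _).
have [strict_l le_l lt_l] := strict_cons sl.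
have [lt_sr|lt_rs|rs] := ltngtP s r.
- exists 1, (r :: s :: l); rewrite scale1r; split=> // [|b /= -> //].
  apply: cons_strict => //; first exact: leq_ltn_trans lt_sr.
  rewrite /= lt_sr; apply: sub_all le_l => x /= le_xs; exact: leq_ltn_trans le_xs lt_sr.
- have s0 : (0 < s)%N by exact: leq_ltn_trans lt_rs.
  have [c [m [strict_m Qvm lt_m]]] := IHl strict_l.
  exists (- c), (s :: m); split; last 2 first.
  + by rewrite Qv_anti // (Qv_consZ _ Qvm) scaleNr.
  + by move=> b lt_rb /= /andP[-> lt_lb]; rewrite lt_m.
  by apply: cons_strict => //; apply: lt_m => //; exact: lt_l.
- subst r; have [s0|s0] := posnP s.
    exists 1, l; rewrite s0 Qv_zeros scale1r; split=> // b _.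
    by rewrite /= => /andP[].
  by exists 0, [::]; rewrite Qv_repeat // scale0r.
Qed.

Lemma Qv_straighten l : exists c m, strict_partition m /\ Qv l = c *: Qv m.
Proof.
elim: l => [|r l [c [m [strict_m E]]]]; first by exists 1, [::]; rewrite scale1r.
have [c' [m' [strict_m' E' _]]] := Qv_insert r strict_m.
by exists (c * c'), m'; split=> //; rewrite (Qv_consZ _ E) E' scalerA.
Qed.

(** * The strict partitions span Gamma *)

Inductive Qvspan (A : seq nat -> Prop) : formal -> Prop :=
| Qvspan0 : Qvspan A 0
| QvspanZD c l f : A l -> Qvspan A f -> Qvspan A (c *: Qv l + f).

Lemma QvspanD A f g : Qvspan A f -> Qvspan A g -> Qvspan A (f + g).
Proof.
move=> Af Ag; elim: Af => [|c l h Al _ IH]; first by rewrite add0r.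
by rewrite -addrA; exact: QvspanZD.
Qed.

Lemma QvspanZ A c f : Qvspan A f -> Qvspan A (c *: f).
Proof.
elim=> [|d l h Al _ IH]; first by rewrite scaler0; exact: Qvspan0.
by rewrite scalerDr scalerA; exact: QvspanZD.
Qed.

Lemma Qvspan_Qv (A : seq nat -> Prop) l : A l -> Qvspan A (Qv l).
Proof. by move=> Al; rewrite -[Qv l]addr0 -[Qv l]scale1r; apply: QvspanZD => //;
  exact: Qvspan0. Qed.

Lemma Qvspan_linear (h : formal -> formal) (A B : seq nat -> Prop) f :
    h 0 = 0 -> (forall c u v, h (c *: u + v) = c *: h u + h v) ->
  (forall l, A l -> Qvspan B (h (Qv l))) -> Qvspan A f -> Qvspan B (h f).
Proof.
move=> h0 hZD hA; elim=> [|c l g Al _ IH]; first by rewrite h0; exact: Qvspan0.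
by rewrite hZD; apply: QvspanD => //; apply/QvspanZ/hA.
Qed.

Lemma Qvspan_mulr g (A B : seq nat -> Prop) f :
  (forall l, A l -> Qvspan B (g * Qv l)) -> Qvspan A f -> Qvspan B (g * f).
Proof.
apply: (@Qvspan_linear (fun f => g * f)); first exact: mulr0.
by move=> c u v; rewrite mulrDr scalerAr.
Qed.

(** Solve [Qv_cons] for q_r Qv(l).  The remaining terms are products
    q_(r + i) q_(x - i) Qv(m) with i > 0 and m the list l without the part x.
    The degree of q_(x - i) Qv(m) is smaller than that of Qv(l), so the induction
    hypothesis on the degree applies to both multiplications. *)
Lemma Qvspan_q d r f :
  Qvspan (fun l => sumn l = d) f -> Qvspan (fun l => sumn l = (r + d)%N) (q r%:Z * f).
Proof.
elim/ltn_ind: d r f => d IHd r f; apply: Qvspan_mulr => l suml.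
have -> : q r%:Z * Qv l = Qv (r :: l) - dsum (Qpair_corr r) Qv l by rewrite Qv_cons addrK.
have VB (A : seq nat -> Prop) u v : Qvspan A u -> Qvspan A v -> Qvspan A (u - v).
  by move=> Au Av; rewrite -scaleN1r; apply/QvspanD/QvspanZ.
apply: (VB); first by apply: Qvspan_Qv => /=; rewrite suml.
apply: dsum_closed; [exact: Qvspan0|exact: VB|move=> x m /perm_sumn /= xm].
rewrite suml in xm; rewrite /Qpair_corr -mulrA big_distrl /= mulr_natl -(@scaler_nat rat).
apply: QvspanZ; elim/big_ind: _ => [|u v|[i lt_ix] _ /=].
- exact: Qvspan0.
- exact: QvspanD.
rewrite -mulrA -sgnZ -mulrA; apply: QvspanZ.
have -> : x%:Z - i.+1%:Z = (x - i.+1)%N%:Z by lia.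
have step : Qvspan (fun l => sumn l = (x - i.+1 + sumn m)%N) (q (x - i.+1)%N%:Z * Qv m).
  by apply: IHd; [lia|exact: Qvspan_Qv].
have lt_d : (x - i.+1 + sumn m < d)%N by lia.
have := IHd _ lt_d (r + i.+1)%N _ step.
by have -> : (r + i.+1 + (x - i.+1 + sumn m) = r + d)%N by lia.
Qed.

(** Multiplication by each q_z preserves the span of the Qv(l), l strict; hence
    so does multiplication by each element of Gamma, and the span contains
    1 = Qv([::]). *)
Lemma Gamma_span f : Gamma f -> Qvspan (fun l => strict_partition l) f.
Proof.
pose V g := forall h, Qvspan (fun l => strict_partition l) h ->
  Qvspan (fun l => strict_partition l) (g * h).
move=> Gf; suff Vf : V f by rewrite -[f]mulr1; apply: Vf; exact: (@Qvspan_Qv _ [::]).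
apply: (@Gamma_ind V) Gf => [h|c u v Vu Vv h Sh|u v Vu Vv h Sh|z h].
- by rewrite mul1r.
- rewrite mulrDl -scalerAl; apply: QvspanD; last exact: Vv.
  by apply: QvspanZ; exact: Vu.
- by rewrite -mulrA; apply: Vu; exact: Vv.
apply: Qvspan_mulr => l strict_l; case: z => r; last first.
  by rewrite q_neg // mul0r; exact: Qvspan0.
have := @Qvspan_q (sumn l) r (Qv l) (Qvspan_Qv (A := fun m => sumn m = sumn l) erefl).
apply: (@Qvspan_linear id) => // m _; have [c [m' [strict_m' ->]]] := Qv_straighten m.
exact/QvspanZ/Qvspan_Qv.
Qed.

Lemma Gamma_dsum a (F : seq nat -> formal) l :
  (forall x m, perm_eq (x :: m) l -> Gamma (a x * F m)) -> Gamma (dsum a F l).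
Proof.
apply: dsum_closed => [|u v Gu Gv]; first exact: Gamma0.
by rewrite -scaleN1r; apply: GammaD => //; exact: GammaZ.
Qed.

Lemma Gamma_Qpair_corr r s : Gamma (Qpair_corr r s).
Proof.
rewrite /Qpair_corr mulr_natl -(@scaler_nat rat); apply: GammaZ; apply: Gamma_sum => i _.
by rewrite -sgnZ; apply: GammaZ; apply: GammaM; exact: Gamma_q.
Qed.

Lemma Gamma_Qv l : Gamma (Qv l).
Proof.
have [n] := ubnP (size l); elim: n l => // n IHn [|r l] /=; first by move=> _; exact: Gamma1.
rewrite ltnS => le_n; rewrite Qv_cons; apply: GammaD.
  by apply: GammaM; [exact: Gamma_q|exact: IHn].
apply: Gamma_dsum => x m /perm_size szl; apply: GammaM; first exact: Gamma_Qpair_corr.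
by apply: IHn; rewrite -szl in le_n; exact: ltnW.
Qed.

(** * V_z as an operator on Gamma *)

(** The second part makes the sum that defines V_z finite on Gamma. *)
Lemma Gamma_addvar f : Gamma f ->
  (forall j, Gamma (addvar f j)) /\ exists N, forall j, (N <= j)%N -> addvar f j = 0.
Proof.
pose V g := (forall j, Gamma (addvar g j)) /\ exists N, forall j, (N <= j)%N -> addvar g j = 0.
apply: (@Gamma_ind V) => [|c u v [Gu [N Nu]] [Gv [N' Nv]]|u v [Gu [N Nu]] [Gv [N' Nv]]|z].
- rewrite /V addvar1; split=> [[|j]|]; rewrite ?fps1; [exact: Gamma1|exact: Gamma0|].
  by exists 1%N => -[|j].
- split=> [j|]; first by rewrite -[addvar _ j]/(c *: addvar u j + addvar v j); exact: GammaZD.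
  exists (maxn N N') => j; rewrite geq_max => /andP[h h'].
  by rewrite -[addvar _ j]/(c *: addvar u j + addvar v j) Nu // Nv // scaler0 addr0.
- rewrite /V addvarM; split=> [j|].
    by rewrite fpsM; apply: Gamma_sum => i _; exact: GammaM.
  exists (N + N')%N => j le_j; rewrite fpsM big1 // => i _.
  have [h|h] := leqP N i; first by rewrite Nu ?mul0r.
  by rewrite [X in _ * X]Nv ?mulr0 //; lia.
split=> [j|]; first rewrite addvar_q.
  apply: GammaM; last exact: Gamma_q.
  by case: j => [|j]; [exact: Gamma1|rewrite /kappa_one -scaler_nat; apply: GammaZ; exact: Gamma1].
by exists `|z|.+1%N => j le_j; rewrite addvar_q q_neg ?mulr0 //; lia.
Qed.

Lemma Gamma_vertex z f : Gamma f -> Gamma (vertex z f).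
Proof.
move=> /Gamma_addvar[Gf [N Nf]]; rewrite /vertex (vertex_evalE _ Nf); apply: Gamma_sum => j _.
by apply: GammaZ; apply: GammaM => //; exact: Gamma_q.
Qed.

Lemma vertex_linear z (c : rat) f g : Gamma f -> Gamma g -> vertex z (c *: f + g) =
  c *: vertex z f + vertex z g.
Proof.
move=> /Gamma_addvar[_ [N Nf]] /Gamma_addvar[_ [N' Ng]].
have Nf' j : (maxn N N' <= j)%N -> addvar f j = 0 by rewrite geq_max => /andP[/Nf].
have Ng' j : (maxn N N' <= j)%N -> addvar g j = 0 by rewrite geq_max => /andP[_ /Ng].
rewrite /vertex (vertex_evalE _ Nf') (vertex_evalE _ Ng') (@vertex_evalE (maxn N N')); last first.
  by move=> j h; rewrite -[addvar _ j]/(c *: addvar f j + addvar g j) Nf' // Ng' // scaler0 addr0.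
rewrite scaler_sumr -big_split /=; apply: eq_bigr => j _.
rewrite -[addvar _ j]/(c *: addvar f j + addvar g j) mulrDr scalerDr -scalerAr !scalerA;
  congr (_ *: _ + _).
exact: mulrC.
Qed.

(** * Pfaffians *)

Lemma lift_perm_surj n (i j : 'I_n.+1) (s : 'S_n.+1) :
  s i = j -> exists s', s = lift_perm i j s'.
Proof.
move=> si; have unl k : {k' | s (lift i k) = lift j k'}.
  have : j != s (lift i k) by rewrite -si (inj_eq perm_inj) neq_lift.
  by case/unlift_some => k' e _; exists k'.
have inj_t : injective (fun k => sval (unl k)).
  move=> a b; case: (unl a) (unl b) => [a' ea] [b' eb] /= ab.
  by apply/(@lift_inj _ i)/(@perm_inj _ s); rewrite ea eb ab.
exists (perm inj_t); apply/permP => k; case: (unliftP i k) => [k'|] ->.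
  by rewrite lift_perm_lift permE; case: (unl k').
by rewrite lift_perm_id.
Qed.

Lemma lift_perm_inj n (i j : 'I_n.+1) : injective (@lift_perm n i j).
Proof.
move=> s t st; apply/permP => k; apply: (@lift_inj _ j).
by rewrite -(lift_perm_lift i) st lift_perm_lift.
Qed.

Lemma sum_lift_perm n (i j : 'I_n.+1) (V : nmodType) (F : 'S_n.+1 -> V) :
  \sum_(s : 'S_n.+1 | s i == j) F s = \sum_(s : 'S_n) F (lift_perm i j s).
Proof.
transitivity (\sum_(s in [set lift_perm i j t | t in [set: 'S_n]]%SET) F s).
  apply: eq_bigl => s; apply/eqP/imsetP => [/lift_perm_surj[t ->]|[t _ ->]].
    by exists t; rewrite ?inE.
  by rewrite lift_perm_id.
rewrite big_imset /=; last by move=> s t _ _; exact: lift_perm_inj.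
by apply: eq_bigl => s; rewrite inE.
Qed.

Section PfaffianExpansion.
Variables (h : nat) (M : 'M[formal]_((h.*2).+2)).
Hypothesis M_skew : forall i j, M i j = - M j i.

Let N := (h.*2).+2.
Let ev (i : 'I_h.+1) : 'I_N := Ordinal (even_index i).
Let od (i : 'I_h.+1) : 'I_N := Ordinal (odd_index i).
Let term (s : 'S_N) : formal := (-1) ^+ s * \prod_(i < h.+1) M (s (ev i)) (s (od i)).

Let ev_inj : injective ev.
Proof. by move=> i j /(congr1 val) /= /double_inj e; apply/val_inj. Qed.
Let od_inj : injective od.
Proof. by move=> i j /(congr1 val) /= [] /double_inj e; apply/val_inj. Qed.
Let ev_od i j : (ev i == od j) = false.
Proof. by apply/negbTE/eqP => /(congr1 (fun k : 'I_N => odd k)) /=; rewrite !odd_double. Qed.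
Let ev0 : ev ord0 = ord0. Proof. exact/val_inj. Qed.

Let evP (t : 'I_N) : {i | t = ev i} + {i | t = od i}.
Proof.
have lt_t : (t./2 < h.+1)%N.
  by rewrite ltnS -(half_bit_double h true) half_leq //= add1n -ltnS.
case odd_t: (odd t); [right|left]; exists (Ordinal lt_t); apply/val_inj => /=;
by rewrite -[LHS]odd_double_half odd_t.
Qed.

Let swap (i : 'I_h.+1) : 'S_N := (tperm (ev ord0) (ev i) * tperm (od ord0) (od i))%g.
Let flip : 'S_N := tperm (ev ord0) (od ord0).

Let term_flip s : term (flip * s)%g = term s.
Proof.
rewrite /term odd_permM odd_tperm ev_od addTb signrN mulNr -mulrN; congr (_ * _).
rewrite (bigD1 ord0) // [in RHS](bigD1 ord0) //= -mulNr; congr (_ * _).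
  by rewrite !permM tpermL tpermR M_skew opprK.
apply: eq_bigr => i ne; rewrite !permM !tpermD //; first [by rewrite ev_od|
  by rewrite eq_sym ev_od|by rewrite (inj_eq ev_inj) eq_sym|by rewrite (inj_eq od_inj) eq_sym].
Qed.

Let swap_ev i k : swap i (ev k) = ev (tperm ord0 i k).
Proof.
rewrite permM [X in tperm (od _) _ X](_ : _ = ev (tperm ord0 i k)).
  by rewrite tpermD // eq_sym ev_od.
case: (tpermP ord0 i k) => [->|->|/eqP n0 /eqP ni]; rewrite ?tpermL ?tpermR //.
by rewrite tpermD // (inj_eq ev_inj) eq_sym.
Qed.

Let swap_od i k : swap i (od k) = od (tperm ord0 i k).
Proof.
rewrite permM [X in tperm (od _) _ X]tpermD ?ev_od //.
case: (tpermP ord0 i k) => [->|->|/eqP n0 /eqP ni]; rewrite ?tpermL ?tpermR //.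
by rewrite tpermD // (inj_eq od_inj) eq_sym.
Qed.

Let term_swap i s : term (swap i * s)%g = term s.
Proof.
rewrite /term !odd_permM !odd_tperm (inj_eq ev_inj) (inj_eq od_inj) addbb /=; congr (_ * _).
rewrite [RHS](reindex_inj (@perm_inj _ (tperm ord0 i))) /=; apply: eq_bigr => k _.
by rewrite !(permM (swap i) s) swap_ev swap_od.
Qed.

Let sum_term_at (t : 'I_N) : \sum_(s : 'S_N | (s^-1)%g ord0 == t) term s =
  \sum_(s : 'S_N | s ord0 == ord0) term s.
Proof.
(* tau permutes the blocks {2i, 2i+1} and possibly flips one of them, which
   does not change the terms, and it moves the position 0 to t. *)
have [tau tau0 tauE] : exists2 tau : 'S_N, tau ord0 = t & forall s, term (tau * s)%g = term s.
  case: (evP t) => [[i ->]|[i ->]].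
    by exists (swap i) => [|s]; rewrite ?term_swap // -ev0 swap_ev tpermL.
  exists (flip * swap i)%g => [|s]; last by rewrite -mulgA term_flip term_swap.
  by rewrite permM -ev0 tpermL swap_od tpermL.
rewrite [RHS](reindex_inj (mulgI tau)) /=; apply: eq_big => s; last by rewrite tauE.
by rewrite permM tau0; apply/eqP/eqP => [<-|<-]; rewrite ?permKV ?permK.
Qed.

(** In the sum over permutations the 2h + 2 positions of the index 0 contribute
    equally, so it may be put in the first position.  Its partner, in the second
    position, is the summation index j, and the rest of the permutation is a
    permutation for the minor. *)
Lemma Pfaffian_expand :
  @Pfaffian h.+1 M = \sum_(j < (h.*2).+1) (-1) ^+ j * (M ord0 (lift ord0 j) *
    @Pfaffian h (\matrix_(a, b) M (lift ord0 (lift j a)) (lift ord0 (lift j b)))).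
Proof.
transitivity ((2 ^+ h.+1 * (h.+1)`!%:R : rat)^-1 *: ((\sum_(s :
  'S_N | s ord0 == ord0) term s) *+ N)).
  rewrite /Pfaffian; congr (_ *: _).
  rewrite (partition_big (fun s : 'S_N => (s^-1)%g ord0) xpredT) //=.
  by under eq_bigr => t _ do rewrite sum_term_at; rewrite sumr_const card_ord.
have -> : \sum_(s : 'S_N | s ord0 == ord0) term s =
    \sum_(j < (h.*2).+1) \sum_(s : 'S_(h.*2)) term (lift_perm ord0 ord0 (lift_perm ord0 j s)).
  rewrite sum_lift_perm (partition_big (fun s : 'S_(h.*2).+1 => s ord0) xpredT) //=.
  by apply: eq_bigr => j _; rewrite sum_lift_perm.
rewrite -(@scaler_nat rat) scalerA scaler_sumr; apply: eq_bigr => j _.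
rewrite /Pfaffian -!scalerAr; congr (_ *: _).
  rewrite /N -doubleS -mul2n factS !natrM exprS.
  have h1 : (h.+1)%:R != 0 :> rat by rewrite pnatr_eq0.
  have h2 : (h`!)%:R != 0 :> rat by rewrite pnatr_eq0 -lt0n fact_gt0.
  have h3 : 2 ^+ h != 0 :> rat by rewrite expf_eq0 andbF.
  by move: (h.+1)%:R (h`!)%:R (2 ^+ h) h1 h2 h3 => a b c a0 b0 c0; field; rewrite a0 b0 c0.
rewrite !mulr_sumr; apply: eq_bigr => s _; rewrite /term !odd_lift_perm /= signr_addb signr_odd.
have od0 : od ord0 = lift ord0 ord0 by exact/val_inj.
have evS (i : 'I_h) : ev (lift ord0 i) =
  lift ord0 (lift ord0 (Ordinal (even_index i))) by exact/val_inj.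
have odS (i : 'I_h) : od (lift ord0 i) =
  lift ord0 (lift ord0 (Ordinal (odd_index i))) by exact/val_inj.
rewrite big_ord_recl ev0 od0 lift_perm_id lift_perm_lift lift_perm_id.
rewrite -mulrA; congr (_ * _); rewrite mulrCA; congr (_ * (_ * _)).
by apply: eq_bigr => i _; rewrite mxE evS odS !lift_perm_lift.
Qed.
End PfaffianExpansion.

Lemma dsumE (R : comNzRingType) a (F : seq nat -> R) l :
  dsum a F l = \sum_(j < size l) (-1) ^+ j * (a (nth 0%N l j) * F (take j l ++ drop j.+1 l)).
Proof.
elim: l F => [|x l IHl] F; first by rewrite big_ord0.
rewrite [LHS]/= IHl big_ord_recl /= drop0 mul1r -sumrN; congr (_ + _).
by apply: eq_bigr => j _; rewrite /bump /= add1n exprS mulN1r mulNr.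
Qed.

Lemma nth_del (l : seq nat) j i : (j < size l)%N ->
  nth 0%N (take j l ++ drop j.+1 l) i = nth 0%N l (bump j i).
Proof.
move=> lt_j; rewrite nth_cat size_take lt_j /bump.
case: ltnP => [lt_ij|le_ji] /=; first by rewrite nth_take.
by rewrite nth_drop add1n addSn subnKC.
Qed.

(** The matrix in the definition of Q, in any size: beyond the end of [l] the
    parts are 0. *)
Definition Qmx (l : seq nat) n : 'M[formal]_n := \matrix_(i, j)
  if (i < j)%N then Qpair (nth 0%N l i)%:Z (nth 0%N l j)%:Z
  else if (j < i)%N then - Qpair (nth 0%N l j)%:Z (nth 0%N l i)%:Z else 0.

Lemma Qmx_skew l n i j : Qmx l n i j = - Qmx l n j i.
Proof. by rewrite !mxE; case: ltngtP => _; rewrite ?opprK ?oppr0. Qed.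

(** Induction along the first row.  For a list of odd length [dsum_q_Qv] turns
    the summands q_x q_s of the row entries into q_x Qv(l), which gives the
    recursion [Qv_cons]. *)
Lemma Pfaffian_Qmx h l : size l = h.*2 -> Pfaffian (Qmx l h.*2) = Qv l.
Proof.
elim: h l => [|h IHh] [|x l] //= szl.
  rewrite /Pfaffian mulr1 invr1 scale1r (big_pred1 1%g) => [|s].
    by rewrite odd_perm1 big_ord0 mulr1.
  by apply/esym/eqP/permP; case.
case: szl => szl; rewrite -[h.+1.*2]/(h.*2).+2 (Pfaffian_expand (@Qmx_skew _ _)).
rewrite Qv_cons.
transitivity (dsum (fun s => q x%:Z * q s%:Z + Qpair_corr x s) Qv l); last first.
  by rewrite dsumDl dsumZl dsum_q_Qv szl /= odd_double.
rewrite dsumE szl; apply: eq_bigr => j _.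
have lt_j : (j < size l)%N by rewrite szl.
have -> : Qmx (x :: l) (h.*2).+2 ord0 (lift ord0 j) =
  q x%:Z * q (nth 0%N l j)%:Z + Qpair_corr x (nth 0%N l j).
  by rewrite mxE -QpairE.
suff -> : \matrix_(a, b) Qmx (x :: l) (h.*2).+2 (lift ord0 (lift j a)) (lift ord0 (lift j b)) =
    Qmx (take j l ++ drop j.+1 l) h.*2.
  by rewrite IHh // size_cat size_take lt_j size_drop szl; have := ltn_ord j; lia.
have lt_bump a b : (bump j a < bump j b)%N = (a < b)%N by rewrite ltnNge leq_bump2 -ltnNge.
by apply/matrixP => a b; rewrite !mxE !lift0 /= !ltnS !lt_bump !nth_del.
Qed.

(** This agrees with the convention that a part 0 completes a list of odd
    length. *)
Lemma Qv_rcons0 l : Qv (rcons l 0%N) = Qv l.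
Proof.
have Qv0 : Qv [:: 0%N] = 1 by rewrite Qv_cons /= addr0 mulr1 q0.
by rewrite /Qv foldr_rcons -[_ *: _]/(Qv [:: 0%N]) Qv0.
Qed.

Lemma Qs_Qv l : Qs l = Qv l.
Proof.
have nthE i : [seq Posz x | x <- l]`_i = (nth 0%N l i)%:Z :> int.
  by have [lt_i|le_i] := ltnP i (size l); [rewrite (nth_map 0%N)|rewrite !nth_default ?size_map].
pose l' := if odd (size l) then rcons l 0%N else l.
have nth' i : nth 0%N l i = nth 0%N l' i.
  rewrite /l'; case: ifP => // _; rewrite nth_rcons; case: ltngtP => // h;
    last by rewrite nth_default ?h.
  by rewrite nth_default // ltnW.
have size' : size l' = (uphalf (size l)).*2.
  rewrite /l' uphalf_half doubleD; case: ifP => odd_l;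
    rewrite ?size_rcons -[in LHS](odd_double_half (size l)) odd_l //.
have -> : Qv l = Qv l' by rewrite /l'; case: ifP => _; rewrite ?Qv_rcons0.
rewrite -(Pfaffian_Qmx size') /Qs /Q size_map; congr Pfaffian; apply/matrixP => i j.
by rewrite !mxE !nthE !nth'.
Qed.

(** * D_k is V_(-k) *)

Lemma is_D_vertex k : (0 < k)%N -> is_D k (vertex (- k%:Z)).
Proof.
move=> k0; split=> [f|c f g|l strict_l]; [exact: Gamma_vertex|exact: vertex_linear|].
by rewrite !Qs_Qv vertex_Qv_strict.
Qed.

(** Both sides are linear on Gamma and agree on the Q_l, l strict, which
    span. *)
Lemma D_vertex k f : (0 < k)%N -> Gamma f -> D k f = vertex (- k%:Z) f.
Proof.
move=> k0 Gf; have is_D_V := is_D_vertex k0.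
have [_ DZD DQ] : is_D k (D k) by exact: (xgetPex (fun=> 0) (ex_intro _ _ is_D_V)).
have [_ VZD VQ] := is_D_V.
have Dk0 : D k 0 = 0.
  have := DZD 1 0 0 Gamma0 Gamma0; rewrite !scale1r addr0 => /eqP.
  by rewrite -subr_eq0 opprD addrA subrr sub0r oppr_eq0 => /eqP.
have V0 : vertex (- k%:Z) 0 = 0.
  have := VZD 1 0 0 Gamma0 Gamma0; rewrite !scale1r addr0 => /eqP.
  by rewrite -subr_eq0 opprD addrA subrr sub0r oppr_eq0 => /eqP.
suff [] : Gamma f /\ D k f = vertex (- k%:Z) f by [].
elim: (Gamma_span Gf) => [|c l g strict_l _ [Gg IH]]; first by rewrite Dk0 V0; split;
  first exact: Gamma0.
have Gl := Gamma_Qv l; split; first exact: GammaZD.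
by rewrite DZD // VZD // IH -Qs_Qv DQ // VQ.
Qed.

(** * The plethysm in one more variable *)

(** The exponents of z taken from the factors of the squares are recorded by
    two functions on the index set of the product; the remaining exponent is taken
    from [h]. *)
Lemma coef_mul_prod_sqr (R : comNzRingType) m (h : fps R) (F : 'I_m -> fps R) n :
  (h * \prod_(s < m) (F s * F s)) n =
  \sum_(fg : {ffun 'I_m -> 'I_n.+1} * {ffun 'I_m -> 'I_n.+1})
    (if (\sum_s fg.1 s + \sum_s fg.2 s <= n)%N
     then h (n - (\sum_s fg.1 s + \sum_s fg.2 s))%N else 0) *
    \prod_(s < m) (F s (fg.1 s) * F s (fg.2 s)).
Proof.
have trunc_prod : \prod_(s < m) fps_trunc n.+1 (F s) =
    \sum_(f : {ffun 'I_m -> 'I_n.+1}) (\prod_s F s (f s)) *: 'X^(\sum_s f s).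
  under eq_bigr => s _ do rewrite /fps_trunc poly_def.
  rewrite bigA_distr_bigA; apply: eq_bigr => f _ /=.
  rewrite scaler_prod; congr (_ *: _).
  by rewrite (big_morph (fun d => 'X^d : {poly R}) (exprD 'X) (expr0 'X)).
rewrite big_split /= -[LHS]/(fps_mul _ _ _) -(@fps_mul_trunc _ n.+1) //.
rewrite (@coefM_eq _ n.+1 _ (fps_trunc n.+1 h) _
  ((\prod_(s < m) fps_trunc n.+1 (F s)) * (\prod_(s < m) fps_trunc n.+1 (F s)))) //; last first.
  move=> i lt_in; rewrite fps_truncM //; apply: (@coefM_eq _ n.+1) => // j lt_jn;
  by rewrite coef_poly lt_jn coef_prod_trunc.
rewrite trunc_prod big_distrlr pair_bigA /= mulr_sumr coef_sum; apply: eq_bigr => -[f g] _ /=.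
rewrite -scalerAl -!scalerAr scalerA -exprD coefZ coefMXn coef_poly -big_split /=.
by rewrite mulrC ltnS leq_subr; case: leqP.
Qed.

Lemma twistM s g h : twist s (g * h) = twist s g * twist s h.
Proof. by rewrite /twist !rmorphM. Qed.

Lemma addvar_q_support m s : (m < s)%N -> addvar (q m%:Z) s = 0.
Proof. by move=> lt_ms; rewrite addvar_q q_neg ?mulr0 //; lia. Qed.

(** The coefficient of x^s in q_m(A, x) is 2 q_(m - s) for s > 0, and
    kappa(2 P) = kappa(P)^2. *)
Lemma addvar_kappa_q m :
  fps_map addvar (kappa (q m%:Z)) = twist 0 (kappa (q m%:Z)) *
    \prod_(s < m) (twist s.+1 (kappa (q (m%:Z - s.+1%:Z))) *
                   twist s.+1 (kappa (q (m%:Z - s.+1%:Z)))).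
Proof.
rewrite (addvar_kappa (M := m.+1)); last exact: addvar_q_support.
rewrite big_ord_recl addvar_q mul1r subr0; congr (_ * _); apply: eq_bigr => s _.
by rewrite lift0 addvar_q /kappa_one mulr_natl mulr2n kappaD twistM.
Qed.

Lemma vertex_eval_sum_mono (I : finType) z (c : I -> formal) (d : I -> nat) :
  vertex_eval z (\sum_i fps_cst (c i) * fps_mono _ (d i)) =
  \sum_i (-1 : rat) ^ (z + (d i)%:Z) *: (q (z + (d i)%:Z) * c i).
Proof.
pose N := (\sum_i d i).+1.
have lt_dN i : (d i < N)%N by rewrite ltnS (bigD1 i) //= leq_addr.
rewrite (@vertex_evalE N) => [|j le_Nj]; last first.
  rewrite fps_sum big1 // => i _; rewrite fps_cstM /fps_mono gtn_eqF ?mulr0 //.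
  exact: leq_trans le_Nj.
under eq_bigr => j _ do rewrite fps_sum mulr_sumr scaler_sumr.
rewrite exchange_big /=; apply: eq_bigr => i _.
rewrite (bigD1 (Ordinal (lt_dN i))) //= fps_cstM /fps_mono eqxx mulr1 big1 ?addr0 // => j ne.
rewrite fps_cstM; case: eqP => [e|_]; last by rewrite !mulr0 scaler0.
by case/eqP: ne; exact/val_inj.
Qed.

Lemma pleth_neg (z : int) P : z < 0 -> pleth z P = 0.
Proof. by case: z. Qed.

Lemma vertex_pleth z n m :
  vertex z (pleth n%:Z (q m%:Z)) =
  \sum_(fg : {ffun 'I_m -> 'I_n.+1} * {ffun 'I_m -> 'I_n.+1})
    let e := z + (\sum_s (fg.1 s + fg.2 s) * s.+1)%N%:Z in
    (-1 : rat) ^ e *: (q e *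
      (pleth (n%:Z - (\sum_s fg.1 s)%N%:Z - (\sum_s fg.2 s)%N%:Z) (q m%:Z) *
       \prod_(s < m) (pleth (fg.1 s : nat)%:Z (q (m%:Z - s.+1%:Z)) *
                      pleth (fg.2 s : nat)%:Z (q (m%:Z - s.+1%:Z))))).
Proof.
rewrite /vertex -[addvar _]/(fps_map addvar (kappa (q m%:Z)) n) addvar_kappa_q coef_mul_prod_sqr
  -vertex_eval_sum_mono.
congr (vertex_eval _ _); apply: eq_bigr => -[f g] _ /=.
have -> : \prod_(s < m) (twist s.+1 (kappa (q (m%:Z - s.+1%:Z))) (f s) *
      twist s.+1 (kappa (q (m%:Z - s.+1%:Z))) (g s)) =
    fps_cst (\prod_(s < m) (pleth (f s : nat)%:Z (q (m%:Z - s.+1%:Z)) *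
                      pleth (g s : nat)%:Z (q (m%:Z - s.+1%:Z)))) *
    fps_mono _ (\sum_s (f s + g s) * s.+1).
  rewrite rmorph_prod (big_morph (fps_mono formal) (@fps_monoD formal) (fps_mono0 formal)).
  rewrite -big_split; apply: eq_bigr => s _ /=; rewrite !twistE rmorphM /= mulrACA -fps_monoD.
  by rewrite -mulnDr mulnC.
rewrite mulrA rmorphM /=; set a := (\sum_s f s)%N; set b := (\sum_s g s)%N.
suff -> : (if (a + b <= n)%N then twist 0 (kappa (q m%:Z)) (n - (a + b))%N else 0) =
    fps_cst (pleth (n%:Z - a%:Z - b%:Z) (q m%:Z)) by [].
case: leqP => h; last by rewrite pleth_neg ?rmorph0 //; lia.
have -> : n%:Z - a%:Z - b%:Z = (n - (a + b))%N%:Z by lia.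
by rewrite twistE mul0n fps_mono0 mulr1.
Qed.

Theorem theorem4p4 (k n m : nat) (k_gt0 : (0 < k)%N) (n_gt0 : (0 < n)%N)
    (m_gt0 : (0 < m)%N) :
  D k (pleth n%:Z (q m%:Z)) =
  \sum_(IJ \in [set: 'rV[int]_m * 'rV[int]_m])
    let I := IJ.1 in let J := IJ.2 in
    let d := dot_delta (I + J) - k%:Z in
    (-1 : rat) ^ d *: (q d * pleth (n%:Z - isum I - isum J) (q m%:Z) *
      \prod_(s < m) (pleth (I ord0 s) (q (m%:Z - (s.+1)%:Z)) *
                     pleth (J ord0 s) (q (m%:Z - (s.+1)%:Z)))).
Proof.
rewrite D_vertex //; last exact: Gamma_pleth.
rewrite vertex_pleth.
pose row (f : {ffun 'I_m -> 'I_n.+1}) : 'rV[int]_m := \row_s (f s : nat)%:Z.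
have row_inj : injective row.
  move=> f g /matrixP fg; apply/ffunP => s; have := fg ord0 s.
  by rewrite !mxE => -[] /val_inj.
pose rows (fg : {ffun 'I_m -> 'I_n.+1} * {ffun 'I_m -> 'I_n.+1}) := (row fg.1, row fg.2).
(* All other pairs (I, J) have a negative entry or |I| + |J| > n, and then one
   of the factors q vanishes. *)
rewrite [RHS](fsbigE (map rows (index_enum _))); last first.
- move=> [I J] _ /= IJ_out.
  have [/forallP I_nneg|/forallPn[s]] := boolP [forall s, 0 <= I ord0 s]; last first.
    by rewrite -ltNge => neg; rewrite (bigD1 s) //= (pleth_neg _ neg) !(mul0r, mulr0) scaler0.
  have [/forallP J_nneg|/forallPn[s]] := boolP [forall s, 0 <= J ord0 s]; last first.
    by rewrite -ltNge => neg; rewrite (bigD1 s) //= (pleth_neg _ neg) !(mul0r, mulr0) scaler0.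
  rewrite pleth_neg ?(mul0r, mulr0) ?scaler0 // ltNge; apply: contra IJ_out => le_n.
  have isum_ge (v : 'rV[int]_m) (s : 'I_m) : (forall s, 0 <= v ord0 s) -> v ord0 s <= isum v.
    by move=> v_ge0; rewrite /isum (bigD1 s) //= lerDl sumr_ge0.
  have isum_ge0 (v : 'rV[int]_m) : (forall s, 0 <= v ord0 s) -> 0 <= isum v.
    by move=> v_ge0; rewrite sumr_ge0.
  have I0 := isum_ge0 _ I_nneg; have J0 := isum_ge0 _ J_nneg.
  have row_surj (v : 'rV[int]_m) : (forall s, 0 <= v ord0 s) -> isum v <= n%:Z ->
      exists f, v = row f.
    move=> v_ge0 v_le; exists [ffun s => inord `|v ord0 s|%N]; apply/matrixP => i s.
    rewrite !mxE ffunE ord1 inordK; first by rewrite gez0_abs.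
    by have := isum_ge v s v_ge0; have := v_ge0 s; lia.
  have [f ->] : exists f, I = row f by apply: row_surj => //; lia.
  have [g ->] : exists g, J = row g by apply: row_surj => //; lia.
  by apply/mapP; exists (f, g) => //; rewrite mem_index_enum.
- by [].
- rewrite map_inj_uniq ?index_enum_uniq // => -[f g] [f' g'] [] /row_inj -> /row_inj ->.
  by [].
rewrite big_map; under [RHS]eq_bigl => fg do rewrite in_setT.
apply: eq_bigr => -[f g] _ /=.
have isum_row f' : isum (row f') = (\sum_s f' s)%N%:Z.
  rewrite /isum (big_morph Posz PoszD erefl); apply: eq_bigr => s _; by rewrite mxE.
have -> : dot_delta (row f + row g) = (\sum_s (f s + g s) * s.+1)%N%:Z.
  rewrite /dot_delta (big_morph Posz PoszD erefl); apply: eq_bigr => s _.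
  by rewrite !mxE PoszM PoszD.
rewrite !isum_row addrC -mulrA; congr (_ *: (_ * (_ * _))).
by apply: eq_bigr => s _; rewrite !mxE.
Qed.
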